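(* Let $k\ge1$ be an integer, let $\lambda_1,\dots,\lambda_k>0$, put $\Lambda=\sum_{j=1}^k\lambda_j$, and let $\delta,\gamma>0$. Let $\{Y(t)\}_{t\ge0}$ be the inverse Gaussian subordinator with parameters $\delta,\gamma$, let $\{M(t)\}_{t\ge0}$ be a generalized counting process with rates $\lambda_1,\dots,\lambda_k$ independent of $Y$, and let $\mathcal Z_{f_3}(t)=M(Y(t))$. Then the Lévy measure of $\mathcal Z_{f_3}$ is $$\Pi_{f_3}(\mathrm dx)=\frac{\delta}{\sqrt{2\pi}}\sum_{n=1}^\infty\sum_{\Omega(k,n)}\prod_{j=1}^k\frac{\lambda_j^{x_j}}{x_j!}\,\frac{\Gamma(s_k-1/2)}{(\Lambda+\gamma^2/2)^{s_k-1/2}}\,\delta_n(\mathrm dx),$$ where $\Omega(k,n)=\{(x_1,\dots,x_k)\in\mathbb N_0^k:x_1+2x_2+\dots+kx_k=n\}$, $s_k=x_1+x_2+\dots+x_k$, and $\delta_n$ is the Dirac measure at $n$.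
   Context: The generalized counting process (GCP) with positive rates $\lambda_1,\dots,\lambda_k$ is the counting process $\{M(t)\}_{t\ge0}$ with $M(0)=0$ that performs $k$ kinds of jumps of amplitude $1,2,\dots,k$ with rates $\lambda_1,\dots,\lambda_k$, respectively; equivalently it is (in law) the Lévy process $M(t)=\sum_{j=1}^k jN_j(t)$, where $N_1,\dots,N_k$ are independent Poisson processes with intensities $\lambda_1,\dots,\lambda_k$. The inverse Gaussian subordinator (IGS) with parameters $\delta,\gamma>0$ is the subordinator $\{Y(t)\}_{t\ge0}$ such that $Y(t)$ has density $q(x,t)=(2\pi)^{-1/2}\delta t x^{-3/2}\exp\left\{\delta\gamma t-\frac12(\delta^2t^2x^{-1}+\gamma^2x)\right\}$, $x>0$; its Bernstein function is $f_3(s)=\delta\left(\sqrt{2s+\gamma^2}-\gamma\right)$, i.e. $\mathbb E(e^{-sY(t)})=e^{-tf_3(s)}$, $s>0$. *)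

(* Defs.v *)
From HB Require Import structures.
From mathcomp Require Import all_boot all_order all_algebra.
From mathcomp Require Import all_classical all_reals all_analysis.
From mathcomp Require Import complex.

Set Implicit Arguments.
Unset Strict Implicit.
Unset Printing Implicit Defensive.

Import Order.TTheory GRing.Theory Num.Theory.
Import numFieldNormedType.Exports.

Local Open Scope classical_set_scope.
Local Open Scope ring_scope.
Local Open Scope complex_scope.

(* A process is a function [X : R -> T -> E] of a time and an outcome; only its
   values at times [0 <= t] are meaningful, and every condition below is
   restricted to such times. *)

Definition rv_sigma d e (T : measurableType d) (E : measurableType e)
    (X : T -> E) : set (set T) :=
  [set X @^-1` B | B in measurable].

Definition process_sigma d e (R : realType) (T : measurableType d)
    (E : measurableType e) (X : R -> T -> E) : set (set T) :=
  <<s \bigcup_(t in [set t | 0 <= t]) rv_sigma (X t) >>.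

Definition mutually_independent d (T : measurableType d) (R : realType)
    (P : probability T R) (I : finType) (F : I -> set (set T)) : Prop :=
  forall (J : {set I}) (A : I -> set T), (forall i, i \in J -> F i (A i)) ->
    P (\bigcap_(i in [set` J]) A i) = (\prod_(i in J) P (A i))%E.

Definition independent2 d (T : measurableType d) (R : realType)
    (P : probability T R) (F G : set (set T)) : Prop :=
  forall A B, F A -> G B -> P (A `&` B) = (P A * P B)%E.

(* Equality of all finite-dimensional distributions. The processes may live on
   different probability spaces. *)
Definition same_law d d' e (R : realType) (T : measurableType d)
    (T' : measurableType d') (E : measurableType e)
    (P : probability T R) (X : R -> T -> E)
    (P' : probability T' R) (X' : R -> T' -> E) : Prop :=
  forall (n : nat) (t : 'I_n -> R) (A : 'I_n -> set E),
    (forall i, 0 <= t i) -> (forall i, measurable (A i)) ->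
    P (\bigcap_i X (t i) @^-1` A i) = P' (\bigcap_i X' (t i) @^-1` A i).

Section levy.
Context d (T : measurableType d) (R : realType) (P : probability T R).

Definition independent_increments (X : R -> T -> R) : Prop :=
  forall (n : nat) (t : nat -> R),
    0 <= t 0%N -> (forall i, t i <= t i.+1) ->
    mutually_independent P
      (fun i : 'I_n => rv_sigma (fun w => X (t i.+1) w - X (t i) w)).

Definition stationary_increments (X : R -> T -> R) : Prop :=
  forall s h : R, 0 <= s -> 0 <= h -> forall A : set R, measurable A ->
    P ((fun w => X (s + h) w - X s w) @^-1` A) =
    P ((fun w => X h w - X 0 w) @^-1` A).

Definition cadlag (f : R -> R) : Prop :=
  (forall t, 0 <= t -> f @ t^'+ --> f t) /\
  (forall t, 0 < t -> cvg (f @ t^'-)).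

(* Stochastic continuity is not listed: it follows from stationarity of the
   increments and right continuity of the paths. *)
Definition levy_process (X : R -> T -> R) : Prop :=
  [/\ forall t, 0 <= t -> measurable_fun setT (X t),
      {ae P, forall w, X 0 w = 0},
      independent_increments X,
      stationary_increments X
    & forall w, cadlag (X ^~ w)].

Definition subordinator (Y : R -> T -> R) : Prop :=
  [/\ levy_process Y,
      forall t w, 0 <= t -> 0 <= Y t w
    & forall s t w, 0 <= s -> s <= t -> Y s w <= Y t w].

Definition cexp (z : R[i]) : R[i] :=
  (expR (complex.Re z) * cos (complex.Im z)) +i*
  (expR (complex.Re z) * sin (complex.Im z)).

Definition cintegral d' (S : measurableType d') (mu : {measure set S -> \bar R})
    (f : S -> R[i]) : R[i] :=
  (\int[mu]_x complex.Re (f x)) +i* (\int[mu]_x complex.Im (f x)).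

Definition charfun (X : T -> R) (u : R) : R[i] :=
  cintegral P (fun w => cexp (0 +i* (u * X w))).

(* Characteristic exponent of the generating triplet [(sigma2, nu, a)]:
   i a u - sigma2 u^2 / 2 + \int (e^(iux) - 1 - i u x 1_(|x| <= 1)) nu(dx). *)
Definition levy_khintchine_exponent (a sigma2 : R)
    (nu : {measure set R -> \bar R}) (u : R) : R[i] :=
  (0 +i* (a * u)) - (sigma2 * u ^+ 2 / 2)%:C +
  cintegral nu (fun x : R =>
    cexp (0 +i* (u * x)) - 1 -
    (if `|x| <= 1 then 0 +i* (u * x) else 0)).

(* [nu] is the third component of the generating triplet of [X]; the triplet
   is unique, so this determines [nu]. *)
Definition levy_measure_of (X : R -> T -> R) (nu : {measure set R -> \bar R})
    : Prop :=
  [/\ levy_process X,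
      nu [set 0] = 0%E,
      (\int[nu]_x (Num.min 1 (x ^+ 2))%:E < +oo)%E
    & exists a sigma2 : R, 0 <= sigma2 /\
        forall t u : R, 0 <= t ->
          charfun (X t) u = cexp (t%:C * levy_khintchine_exponent a sigma2 nu u)].

Definition counting_process (M : R -> T -> nat) : Prop :=
  [/\ forall t, 0 <= t -> measurable_fun setT (M t),
      forall w, M 0 w = 0%N,
      forall s t w, 0 <= s -> s <= t -> (M s w <= M t w)%N
    & forall t w, 0 <= t -> \forall s \near t^'+, M s w = M t w].

Definition poisson_process (lambda : R) (N : R -> T -> nat) : Prop :=
  [/\ counting_process N,
      levy_process (fun t w => (N t w)%:R)
    & forall t n, 0 < t ->
        P (N t @^-1` [set n]) = (poisson_pmf (lambda * t) n)%:E].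

(* Density at [x > 0] of the inverse Gaussian subordinator at time [t]. *)
Definition igs_density (delta gamma x t : R) : R :=
  (2 * pi) `^ (- 2^-1) * (delta * t) * x `^ (- (3 / 2)) *
  expR (delta * gamma * t -
        (delta ^+ 2 * t ^+ 2 * x^-1 + gamma ^+ 2 * x) / 2).

Definition inverse_gaussian_subordinator (delta gamma : R) (Y : R -> T -> R)
    : Prop :=
  subordinator Y /\
  forall (t : R) (A : set R), 0 < t -> measurable A ->
    P (Y t @^-1` A) =
    (\int[lebesgue_measure]_(x in A `&` [set x : R | (0 < x)%R])
       (igs_density delta gamma x t)%:E)%E.

End levy.

(* A counting process with the law of \sum_(1 <= j <= k) j N_j, the N_j being
   independent Poisson processes of intensities lambda_j. The index [j : 'I_k]
   stands for the amplitude [j.+1]. *)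
Definition generalized_counting_process d (T : measurableType d)
    (R : realType) (P : probability T R) (k : nat) (lambda : 'I_k -> R)
    (M : R -> T -> nat) : Prop :=
  counting_process M /\
  exists (d' : measure_display) (T' : measurableType d')
         (P' : probability T' R) (N : 'I_k -> R -> T' -> nat),
    [/\ forall j, poisson_process P' (lambda j) (N j),
        mutually_independent P' (fun j => process_sigma (N j))
      & same_law P M P' (fun t w => (\sum_(j < k) j.+1 * N j t w)%N)].

Definition euler_gamma (R : realType) (s : R) : R :=
  \int[lebesgue_measure]_(x in `]0, +oo[) (x `^ (s - 1) * expR (- x)).

(* The solutions of x_1 + 2 x_2 + ... + k x_k = n; each of them satisfies
   x_j <= n, so bounding the values by n loses none. *)
Definition Omega (k n : nat) : {set {ffun 'I_k -> 'I_n.+1}} :=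
  [set x : {ffun 'I_k -> 'I_n.+1} | (\sum_(j < k) j.+1 * x j == n)%N].

(* Main.v *)
Require Import Defs.
From HB Require Import structures.
From mathcomp Require Import all_boot all_order all_algebra.
From mathcomp Require Import all_classical all_reals all_analysis.
From mathcomp Require Import measurable_realfun complex ring lra.

Set Implicit Arguments.
Unset Strict Implicit.
Unset Printing Implicit Defensive.

Import Order.TTheory GRing.Theory Num.Theory.
Import numFieldNormedType.Exports.

Local Open Scope classical_set_scope.
Local Open Scope ring_scope.

(** The Levy measure of a Levy process [X] is read off from its small-time
    behaviour: if [E G(X_h) / h] tends to the integral of [G] against [nu] as
    [h] decreases to 0, for every bounded measurable [G] vanishing at 0, and if
    [nu] is finite, then [charfun X_t u] is the exponential of [t] times the
    integral of [exp(iux) - 1]. Indeed the increments being independent and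
    stationary, [charfun X_t = (charfun X_(t/n))^n], and two complex numbers of
    modulus at most 1 satisfy [|a^n - b^n| <= n |a - b|]; with [b] the exponential
    of [t/n] times the integral, the small-time limit makes the right-hand side
    vanish ([levy_charfun_exponent]).

    For the subordinated process [Z_t = M(Y_t)] the small-time limit comes from
    the density of [Y]. Conditioning on [Y] gives
    [E G(Z_h) = \int E G(M(x)) q(x, h) dx], and
    [q(x, h) = h exp(delta gamma h) rho(x) exp(- delta^2 h^2 / (2 x))] where
    [rho(x) = delta / sqrt(2 pi) x^(-3/2) exp(- gamma^2 x / 2)] is the Levy
    density of the inverse Gaussian subordinator. The last factor increases to 1
    as [h] decreases to 0, so monotone convergence gives the limit
    [\int E G(M(x)) rho(x) dx] ([igs_small_time]). Hence [nu] puts the mass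
    [\int P(M(x) = n) rho(x) dx] at [n >= 1] and nothing at 0. Inserting the law
    of [M(x)], a finite sum over [Omega k n] of products of Poisson weights, turns
    this mass into the stated sum of Gamma integrals ([levy_weightE]). The total
    mass is [\int (1 - exp(- Lambda x)) rho(x) dx], which is finite since
    [1 - exp(- Lambda x) <= Lambda x] and [x^(-1/2) exp(- gamma^2 x / 2)] is
    integrable ([igs_levy_density_mass]).

    That [Z] is a Levy process rests on the formula
    [P(M(U_(i+1)) - M(U_i) in A_i for all i) = E \prod_i phi_(A_i)(U_(i+1) - U_i)]
    with [phi_A(h) = P(M(h) in A)], for random times [U_0 <= U_1 <= ...]
    independent of [M] ([time_changed_increments]). When the [U_i] take values in
    a grid this is a countable sum over their values; in general they are
    approached from above by grid-valued times, which changes neither side in the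
    limit: the paths of [M] are locally constant on the right, and [phi_A] is
    Lipschitz. Independence and stationarity of the increments of [Z] are then
    inherited from those of [Y]. *)

(** * Transfer of integrals from indicators to nonnegative functions *)

Section transfer.
Local Open Scope ereal_scope.
Import HBNNSimple.

(** The right-hand side depends on [mu], [W] and [X] only through the integrals of
    [W * \1_B(X)], which is what reduces [integral_transfer] to indicators. *)
Lemma integral_simple_limit d e (S : measurableType d) (E : measurableType e)
    (R : realType) (mu : {measure set S -> \bar R}) (W : S -> R) (X : S -> E)
    (f : E -> R) (mf : measurable_fun setT (EFin \o f)) :
  measurable_fun setT W -> (forall x, 0 <= W x)%R -> measurable_fun setT X ->
  (forall x, 0 <= f x)%R ->
  \int[mu]_x (W x * f (X x))%:E =
  limn (fun n => \sum_(y \in range (nnsfun_approx measurableT mf n))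
     y%:E * \int[mu]_x (W x *
       \1_(nnsfun_approx measurableT mf n @^-1` [set y]) (X x))%:E).
Proof.
move=> mW W0 mX f0; set h := nnsfun_approx measurableT mf.
have hf x : ((h n x)%:E) @[n --> \oo] --> (f x)%:E.
  exact: (@cvg_nnsfun_approx _ _ _ _ measurableT _ mf (fun t _ => f0 t)).
transitivity (\int[mu]_x (limn (fun n => (W x * h n (X x))%:E))).
  apply: eq_integral => x _; apply/esym/cvg_lim => //.
  by under eq_fun do rewrite EFinM; rewrite EFinM; apply: cvgeZl => //; exact: hf.
have mh n : measurable_fun setT (fun x => h n (X x)).
  by apply: measurableT_comp => //; exact: measurable_funP.
rewrite monotone_convergence//; last 3 first.
- by move=> n; apply/measurable_EFinP; exact: measurable_funM.
- by move=> n x _; rewrite lee_fin mulr_ge0.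
- move=> x _ a b ab; rewrite lee_fin ler_wpM2l//.
  exact/lefP/nd_nnsfun_approx.
congr (limn _); apply/funext => n.
have mind y : measurable_fun setT (fun x => W x * \1_(h n @^-1` [set y]) (X x))%R.
  apply: measurable_funM => //; apply: measurableT_comp => //.
transitivity (\int[mu]_x (\sum_(y \in range (h n))
    (y%:E * (W x * \1_(h n @^-1` [set y]) (X x))%:E))).
  apply: eq_integral => x _.
  rewrite (fimfunE (h n) (X x)) EFinM -fsumEFin//.
  rewrite ge0_mule_fsumr//; last first.
    by move=> y; rewrite EFinM nnfun_muleindic_ge0.
  by apply: eq_fsbigr => y _; rewrite -!EFinM; congr EFin; rewrite mulrCA.
have pos y x : 0 <= y%:E * (W x * \1_(h n @^-1` [set y]) (X x))%:E.
  rewrite -EFinM lee_fin mulrCA mulr_ge0//.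
  by rewrite -lee_fin EFinM nnfun_muleindic_ge0.
rewrite ge0_integral_fsum//.
- apply: eq_fsbigr => y /[!inE] -[z _ <-].
  rewrite ge0_integralZl_EFin//; first by move=> x _; rewrite lee_fin mulr_ge0.
  exact/measurable_EFinP.
- move=> y; apply/measurable_EFinP.
  by apply: measurable_funM => //; exact: measurable_cst.
Qed.

(** Two weighted image measures that agree on measurable sets have the same
    integrals. The same statement serves for a density ([W2] the density and [X2]
    the identity), for equality in law ([W1 = W2 = 1]) and for independence ([W2]
    a constant). *)
Lemma integral_transfer d1 d2 e (S1 : measurableType d1) (S2 : measurableType d2)
    (E : measurableType e) (R : realType)
    (mu1 : {measure set S1 -> \bar R}) (mu2 : {measure set S2 -> \bar R})
    (W1 : S1 -> R) (X1 : S1 -> E) (W2 : S2 -> R) (X2 : S2 -> E) (f : E -> R) :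
  measurable_fun setT W1 -> (forall x, 0 <= W1 x)%R -> measurable_fun setT X1 ->
  measurable_fun setT W2 -> (forall x, 0 <= W2 x)%R -> measurable_fun setT X2 ->
  (forall B, measurable B ->
    \int[mu1]_x (W1 x * \1_B (X1 x))%:E = \int[mu2]_x (W2 x * \1_B (X2 x))%:E) ->
  measurable_fun setT f -> (forall x, 0 <= f x)%R ->
  \int[mu1]_x (W1 x * f (X1 x))%:E = \int[mu2]_x (W2 x * f (X2 x))%:E.
Proof.
move=> mW1 W10 mX1 mW2 W20 mX2 eqB mf f0.
have mEf : measurable_fun setT (EFin \o f) by exact/measurable_EFinP.
rewrite (integral_simple_limit _ mEf)// (integral_simple_limit _ mEf)//.
congr (limn _); apply/funext => n; apply: eq_fsbigr => y _.
by rewrite eqB.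
Qed.

End transfer.

(** * Independence for countable values and for product expectations *)

Section countable_valued.
Local Open Scope ereal_scope.

Lemma countable_preimage_decomposition d (T : measurableType d) (C : countType) (X : T -> C)
    (D : set T) (A : set C) :
  D `&` X @^-1` A =
  \bigcup_n (if pickle_inv n is Some c then
               if `[<A c>] then D `&` X @^-1` [set c] else set0 else set0).
Proof.
apply/seteqP; split => [w [Dw Aw]|w [n _]].
- exists (pickle (X w)) => //; rewrite pickleK_inv.
  by case: asboolP.
- case: pickle_inv => [c|//]; case: asboolP => // Ac [Dw /= Xw].
  by split => //=; rewrite Xw.
Qed.

Lemma measurable_countable_preimage d (T : measurableType d) (C : countType)
    (X : T -> C) (A : set C) :
  (forall c, measurable (X @^-1` [set c])) -> measurable (X @^-1` A).
Proof.
move=> mX; rewrite -[X in measurable X]setTI countable_preimage_decomposition.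
apply: bigcup_measurable => n _; case: pickle_inv => [c|//].
by case: asboolP => // _; rewrite setTI.
Qed.

(** Both sides are sums over the fibres of [X] and [X'], indexed by the codes of
    the countable type. *)
Lemma countable_preimage_measure_eq d d' (T : measurableType d) (T' : measurableType d')
    (R : realType) (P : {measure set T -> \bar R}) (P' : {measure set T' -> \bar R})
    (C : countType) (X : T -> C) (X' : T' -> C) (D : set T) (D' : set T')
    (k : R) (A : set C) :
  (forall c, measurable (X @^-1` [set c])) ->
  (forall c, measurable (X' @^-1` [set c])) -> measurable D -> measurable D' -> (0 <= k)%R ->
  (forall c, P (D `&` X @^-1` [set c]) = k%:E * P' (D' `&` X' @^-1` [set c])) ->
  P (D `&` X @^-1` A) = k%:E * P' (D' `&` X' @^-1` A).
Proof.
move=> mX mX' mD mD' k0 Pc; rewrite !countable_preimage_decomposition.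
have disj (S : Type) (Y : S -> C) (E : set S) : trivIset setT
    (fun n => if pickle_inv n is Some c then
                if `[<A c>] then E `&` Y @^-1` [set c] else set0 else set0).
  apply/trivIsetP => i j _ _; apply: contra_neqP => /eqP/set0P[w []].
  case ei: (pickle_inv i) => [c|//]; case ej: (pickle_inv j) => [c'|//].
  case: asboolP => // _ [_ /= Yc]; case: asboolP => // _ [_ /= Yc'].
  have := @pickle_invK C i; have := @pickle_invK C j.
  by rewrite ei ej /= -Yc -Yc' => <- <-.
rewrite !measure_bigcup//=; last 2 first.
- move=> n _; case: pickle_inv => [c|//]; case: asboolP => // _.
  exact: measurableI.
- move=> n _; case: pickle_inv => [c|//]; case: asboolP => // _.
  exact: measurableI.
rewrite -nneseriesZl//; apply: eq_eseriesr => n _.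
case: pickle_inv => [c|]; last by rewrite !measure0 mule0.
by case: asboolP; rewrite ?measure0 ?mule0.
Qed.

Lemma bigcapD1_fin (I : finType) (T : Type) (F : I -> set T) (j : I) :
  \bigcap_i F i = (\bigcap_(i in [set i | i != j]) F i) `&` F j.
Proof.
apply/seteqP; split => [w Fw|w [Fw Fj] i _]; first by split => [i _|]; exact: Fw.
by have [->//|ij] := eqVneq i j; exact: Fw.
Qed.

(** A rectangle is reached from a point by freeing one coordinate at a time, each
    step being countable additivity in that coordinate. The [X' i]
    only carry the marginal laws, possibly on another probability space. *)
Lemma product_law_of_points d d' (T : measurableType d) (T' : measurableType d')
    (R : realType) (P : probability T R) (P' : probability T' R)
    (I : finType) (C : countType) (X : I -> T -> C) (X' : I -> T' -> C) :
  (forall i c, measurable (X i @^-1` [set c])) ->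
  (forall i c, measurable (X' i @^-1` [set c])) ->
  (forall x : I -> C,
    P (\bigcap_i X i @^-1` [set x i]) = \prod_i P' (X' i @^-1` [set x i])) ->
  forall A : I -> set C,
    P (\bigcap_i X i @^-1` A i) = \prod_i P' (X' i @^-1` A i).
Proof.
move=> mX mX' Ppt.
suff H (s : seq I) (A : I -> set C) :
    (forall i, i \notin s -> exists c, A i = [set c]) ->
    P (\bigcap_i X i @^-1` A i) = \prod_i P' (X' i @^-1` A i).
  by move=> A; apply: (H (enum I)) => i; rewrite mem_enum.
elim: s A => [|j s IH] A As.
  have /choice[x Ax] : forall i, exists c, A i = [set c] by move=> i; exact: As.
  under eq_bigcapr do rewrite Ax.
  by under [RHS]eq_bigr do rewrite Ax.
have kE : \prod_(i | i != j) P' (X' i @^-1` A i) =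
    (\prod_(i | i != j) fine (P' (X' i @^-1` A i)))%R%:E.
  rewrite -prodEFin; apply: eq_bigr => i _; rewrite fineK// fin_num_measure//.
  exact: measurable_countable_preimage.
rewrite (bigcapD1_fin _ j) (bigD1 j)//= muleC kE.
rewrite -(setTI (X' j @^-1` _)); apply: countable_preimage_measure_eq => //.
- apply: fin_bigcap_measurable; first exact: finite_finset.
  by move=> i _; exact: measurable_countable_preimage.
- by apply: prodr_ge0 => i _; exact: fine_ge0.
- rewrite -kE => c; rewrite setTI; pose B i := if i == j then [set c] else A i.
  have /IH : forall i, i \notin s -> exists c, B i = [set c].
    move=> i si; rewrite /B; case: eqVneq => [_|ij]; first by exists c.
    by apply: As; rewrite inE negb_or ij.
  rewrite (bigcapD1_fin _ j) (bigD1 j)//= {2 3}/B eqxx muleC.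
  under eq_bigcapr => i /negbTE ij do rewrite /B ij.
  by under [in RHS]eq_bigr => i /negbTE ij do rewrite /B ij.
Qed.

End countable_valued.

Section product_expectation.
Local Open Scope ereal_scope.

Lemma integral_indic_comp d e (T : measurableType d) (E : measurableType e)
    (R : realType) (P : {measure set T -> \bar R}) (X : T -> E) (B : set E) :
  measurable_fun setT X -> measurable B ->
  \int[P]_w (\1_B (X w) : R)%:E = P (X @^-1` B).
Proof.
move=> mX mB.
transitivity (\int[P]_w (\1_(X @^-1` B) w : R)%:E); first exact: eq_integral.
by rewrite integral_indic ?setIT// -[X in measurable X]setTI; exact: mX.
Qed.

(** Indicators are replaced by functions one factor at a time: the product of the
    other factors serves as the weight in [integral_transfer]. The bound by 1 keeps
    the partial products finite. *)
Lemma integral_prod_independent d e (T : measurableType d) (E : measurableType e)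
    (R : realType) (P : probability T R) (I : finType) (X : I -> T -> E)
    (f : I -> E -> R) :
  (forall i, measurable_fun setT (X i)) ->
  (forall B : I -> set E, (forall i, measurable (B i)) ->
     P (\bigcap_i X i @^-1` B i) = \prod_i P (X i @^-1` B i)) ->
  (forall i, measurable_fun setT (f i)) ->
  (forall i x, 0 <= f i x <= 1)%R ->
  \int[P]_w (\prod_i f i (X i w))%R%:E = \prod_i \int[P]_w (f i (X i w))%:E.
Proof.
move=> mX indep.
suff H (s : seq I) : (forall i, measurable_fun setT (f i)) ->
    (forall i x, 0 <= f i x <= 1)%R ->
    (forall i, i \notin s -> exists2 B, measurable B & f i = \1_B) ->
    \int[P]_w (\prod_i f i (X i w))%R%:E = \prod_i \int[P]_w (f i (X i w))%:E.
  by move=> mf f01; apply: (H (enum I)) => // i; rewrite mem_enum.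
elim: s f => [|j s IH] f mf f01 fs.
  have /choice[B BP] : forall i, exists B, measurable B /\ f i = \1_B.
    by move=> i; have [//|B mB ->] := fs i; exists B.
  transitivity (\prod_i P (X i @^-1` B i)); last first.
    apply: eq_bigr => i _; rewrite (BP i).2 integral_indic_comp//.
    exact: (BP i).1.
  rewrite -indep; last by move=> i; exact: (BP i).1.
  have mcap : measurable (\bigcap_i X i @^-1` B i).
    apply: fin_bigcap_measurable; first exact: finite_finset.
    by move=> i _; rewrite -[X in measurable X]setTI; apply: mX => //; exact: (BP i).1.
  transitivity (\int[P]_w (\1_(\bigcap_i X i @^-1` B i) w : R)%:E); last first.
    by rewrite integral_indic// setIT.
  apply: eq_integral => w _; congr EFin.
  rewrite indicE; case: (boolP (w \in _)) => [/set_mem wB|/negP wB].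
    rewrite big1// => i _; rewrite (BP i).2 indicE mem_set//.
    exact: wB.
  have [i nBi] : exists i, ~ B i (X i w).
    by apply/existsNP => H; apply: wB; apply/mem_set => i _; exact: H.
  by rewrite (bigD1 i)//= (BP i).2 indicE memNset// mul0r.
have f0 i x : (0 <= f i x)%R by case/andP: (f01 i x).
have f1 i x : (f i x <= 1)%R by case/andP: (f01 i x).
have mfX i : measurable_fun setT (fun w => f i (X i w)).
  exact: measurableT_comp.
have Ifin i : \int[P]_w (f i (X i w))%:E \is a fin_num.
  rewrite ge0_fin_numE; last by apply: integral_ge0 => w _; rewrite lee_fin.
  apply: (@le_lt_trans _ _ (\int[P]_w 1)); last first.
    by rewrite integral_cst//= probability_setT mule1 ltry.
  apply: ge0_le_integral => //; first by move=> w _; rewrite lee_fin.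
  - exact/measurable_EFinP.
  - by move=> w _; rewrite lee_fin.
pose k := (\prod_(i | i != j) fine (\int[P]_w (f i (X i w))%:E))%R.
have kE : \prod_(i | i != j) \int[P]_w (f i (X i w))%:E = k%:E.
  rewrite /k -prodEFin; apply: eq_bigr => i _; by rewrite fineK.
have k0 : (0 <= k)%R.
  by apply: prodr_ge0 => i _; apply/fine_ge0/integral_ge0 => w _; rewrite lee_fin.
rewrite (bigD1 j)//= kE muleC.
rewrite -ge0_integralZl_EFin//; last 2 first.
- by move=> w _; rewrite lee_fin.
- exact/measurable_EFinP.
transitivity (\int[P]_w ((\prod_(i | i != j) f i (X i w)) * f j (X j w))%:E).
  by apply: eq_integral => w _; rewrite (bigD1 j)//= mulrC.
apply: (@integral_transfer _ _ _ _ _ E R P P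
  (fun w => \prod_(i | i != j) f i (X i w))%R (X j) (fun=> k) (X j) (f j)) => //.
- by under eq_fun do rewrite -big_filter; exact: measurable_prod.
- by move=> w; exact: prodr_ge0.
- move=> B mB; pose g i := if i == j then \1_B else f i.
  have gP : \int[P]_w (\prod_i g i (X i w))%R%:E = \prod_i \int[P]_w (g i (X i w))%:E.
    apply: IH => [i|i x|i si]; rewrite /g; case: eqVneq => [_|ij] //.
    - by rewrite indicE; case: (x \in B); rewrite ?lexx ?ler01.
    - by exists B.
    - by apply: fs; rewrite inE negb_or ij.
  transitivity (\int[P]_w (\prod_i g i (X i w))%R%:E).
    apply: eq_integral => w _; rewrite [in RHS](bigD1 j)//= {1}/g eqxx mulrC.
    congr (_ * _)%:E; apply: eq_bigr => i /negbTE ij; by rewrite /g ij.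
  rewrite gP (bigD1 j)//= {1}/g eqxx.
  transitivity (\int[P]_w (\1_B (X j w))%:E * k%:E).
    congr (_ * _); rewrite -kE; apply: eq_bigr => i /negbTE ij.
    by rewrite /g ij.
  rewrite muleC -ge0_integralZl_EFin//.
  apply/measurable_EFinP; apply: measurableT_comp => //.
Qed.

End product_expectation.

(** * Increments of independent Poisson processes *)

Section process_sigma_algebra.
Context d e (R : realType) (T : measurableType d) (E : measurableType e).
Implicit Type X : R -> T -> E.

(** By conversion [process_sigma X] is the set of measurable sets of
    [g_sigma_algebraType (process_generator X)], so measurability with respect to
    the path of [X] can be handled as ordinary measurability. *)
Definition process_generator X : set (set T) :=
  \bigcup_(t in [set t : R | 0 <= t]) rv_sigma (X t).

Lemma measurable_process_generator X (t : R) : 0 <= t ->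
  measurable_fun [set: g_sigma_algebraType (process_generator X)] (X t).
Proof.
move=> t0 _ B mB; rewrite setTI; apply: sub_sigma_algebra.
by exists t => //; exists B.
Qed.

Lemma process_sigma_sub X :
  (forall t, 0 <= t -> measurable_fun setT (X t)) ->
  process_sigma X `<=` measurable.
Proof.
move=> mX; apply: smallest_sub; first exact: sigma_algebra_measurable.
move=> _ [t /= t0 [B mB <-]]; rewrite -[X in measurable X]setTI.
exact: mX.
Qed.

End process_sigma_algebra.

Lemma measurable_fun_fiber d (T : measurableType d) (X : T -> nat) (A : set nat) :
  measurable_fun setT X -> measurable (X @^-1` A).
Proof. by move=> mX; rewrite -[X in measurable X]setTI; exact: mX. Qed.

(** The pair [(X, Y)] has countably many values. *)
Lemma measurable_increment d (T : measurableType d) (X Y : T -> nat) (A : set nat) :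
  measurable_fun setT X -> measurable_fun setT Y ->
  measurable [set w | A (X w - Y w)%N].
Proof.
move=> mX mY.
have := @measurable_countable_preimage _ _ (nat * nat)%type
  (fun w => (X w, Y w)) [set p | A (p.1 - p.2)%N]; apply => -[a b].
rewrite [X in measurable X](_ : _ = X @^-1` [set a] `&` Y @^-1` [set b]).
  by apply: measurableI; exact: measurable_fun_fiber.
by apply/seteqP; split => w /= [-> ->].
Qed.

Lemma bigcap_finsetT (I : finType) (T : Type) (F : I -> set T) :
  \bigcap_(i in [set` [set: I]%SET]) F i = \bigcap_i F i.
Proof.
by apply/seteqP; split => w H i _; apply: H => //=; rewrite inE.
Qed.

Section poisson_increments.
Local Open Scope ereal_scope.
Context d (T : measurableType d) (R : realType) (P : probability T R).

Lemma poisson_increments (lambda : R) (N : R -> T -> nat) (n : nat) (g : nat -> R)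
    (v : 'I_n -> nat) :
  poisson_process P lambda N -> (0 <= g 0%N)%R -> (forall i, g i <= g i.+1)%R ->
  P (\bigcap_(i : 'I_n) [set w | (N (g i.+1) w - N (g i) w)%N = v i]) =
  \prod_(i < n) P (N (g i.+1 - g i)%R @^-1` [set v i]).
Proof.
move=> [[mN N0 Nnd _] [_ _ indep stat _] _] g0 gnd.
have gge0 i : (0 <= g i)%R.
  by elim: i => [//|i /le_trans]; apply; exact: gnd.
have E i m : [set w | (N (g i.+1) w - N (g i) w)%N = m] =
    (fun w => (N (g i.+1) w)%:R - (N (g i) w)%:R : R)%R @^-1` [set m%:R].
  apply/seteqP; split => w /=; rewrite -natrB ?Nnd//; first by move=> ->.
  by move/eqP; rewrite eqr_nat => /eqP.
have := indep n g g0 gnd [set: 'I_n]%SET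
  (fun i => [set w | (N (g i.+1) w - N (g i) w)%N = v i]).
rewrite bigcap_finsetT => ->; last by move=> i _; exists [set (v i)%:R] => //; rewrite E.
under eq_bigl do rewrite inE.
apply: eq_bigr => i _; rewrite E.
have h0 : (0 <= g i.+1 - g i)%R by rewrite subr_ge0.
have := stat (g i) (g i.+1 - g i)%R (gge0 i) h0 [set (v i)%:R] (measurable_set1 _).
rewrite addrC subrK => ->; congr (P _).
apply/seteqP; split => w /=; rewrite N0 subr0; last by move=> ->.
by move/eqP; rewrite eqr_nat => /eqP.
Qed.

End poisson_increments.

Lemma ffun_fiber (T : Type) (k : nat) (f : 'I_k -> T -> nat) (c : {ffun 'I_k -> nat}) :
  (fun w => [ffun j => f j w]) @^-1` [set c] = \bigcap_(j : 'I_k) (f j @^-1` [set c j]).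
Proof.
apply/seteqP; split => w /= H; first by move=> j _ /=; rewrite -H ffunE.
by apply/ffunP => j; rewrite ffunE; exact: H.
Qed.

Section poisson_vector.
Local Open Scope ereal_scope.
Context d (T : measurableType d) (R : realType) (P : probability T R).
Variables (k : nat) (lambda : 'I_k -> R) (N : 'I_k -> R -> T -> nat).
Hypothesis poisN : forall j, poisson_process P (lambda j) (N j).
Hypothesis indepN : mutually_independent P (fun j => process_sigma (N j)).

Let mN j t : (0 <= t)%R -> measurable_fun setT (N j t).
Proof. by move=> t0; have [[mN _ _ _] _ _] := poisN j; exact: mN. Qed.

(** At points, the event splits into one event per process; independence of the
    processes, then of the increments of each of them, gives a double product,
    which is regrouped by time interval. [product_law_of_points] passes from points
    to sets of vectors. *)
Lemma poisson_vector_increments (n : nat) (g : nat -> R)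
    (A : 'I_n -> set {ffun 'I_k -> nat}) :
  (0 <= g 0%N)%R -> (forall i, g i <= g i.+1)%R ->
  P (\bigcap_(i : 'I_n)
       [set w | A i [ffun j => (N j (g i.+1) w - N j (g i) w)%N]]) =
  \prod_(i < n) P [set w | A i [ffun j => N j (g i.+1 - g i)%R w]].
Proof.
move=> g0 gnd.
have gge0 i : (0 <= g i)%R.
  by elim: i => [//|i /le_trans]; apply; exact: gnd.
have indep_rect (B : 'I_k -> set T) : (forall j, process_sigma (N j) (B j)) ->
    P (\bigcap_(j : 'I_k) B j) = \prod_(j < k) P (B j).
  move=> BN; have := indepN (J := [set: 'I_k]%SET) (A := B) (fun j _ => BN j).
  by under eq_bigl do rewrite inE; rewrite bigcap_finsetT.
apply: (@product_law_of_points _ _ _ _ _ P P _ _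
  (fun (i : 'I_n) w => [ffun j => (N j (g i.+1) w - N j (g i) w)%N])
  (fun (i : 'I_n) w => [ffun j => N j (g i.+1 - g i)%R w])).
- move=> i c; rewrite ffun_fiber; apply: fin_bigcap_measurable => //.
  by move=> j _; apply: (@measurable_increment _ _ _ _ [set c j]); exact: mN.
- move=> i c; rewrite ffun_fiber; apply: fin_bigcap_measurable => //.
  by move=> j _; apply: (@measurable_fun_fiber _ _ _ [set c j]); apply: mN; rewrite subr_ge0.
move=> x; under eq_bigcapr do rewrite ffun_fiber.
under [RHS]eq_bigr do rewrite ffun_fiber.
rewrite (_ : \bigcap_i _ = \bigcap_(j : 'I_k) \bigcap_(i : 'I_n)
    [set w | (N j (g i.+1) w - N j (g i) w)%N = x i j]); last first.
  by apply/seteqP; split => w H i _ j _; exact: H.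
rewrite indep_rect; last first.
  move=> j; apply: (@fin_bigcap_measurable _
    (g_sigma_algebraType (process_generator (N j)))) => //.
  move=> i _; apply: (@measurable_increment _
    (g_sigma_algebraType (process_generator (N j))) _ _ [set x i j]);
  exact: measurable_process_generator.
transitivity (\prod_(j < k) \prod_(i < n) P (N j (g i.+1 - g i)%R @^-1` [set x i j])).
  by apply: eq_bigr => j _; exact: (poisson_increments (fun i => x i j) (poisN j)).
rewrite exchange_big/=; apply: eq_bigr => i _.
rewrite indep_rect// => j; apply: (@measurable_fun_fiber _
    (g_sigma_algebraType (process_generator (N j))) _ [set x i j]).
by apply: measurable_process_generator; rewrite subr_ge0.
Qed.

Lemma weighted_poisson_pmf (h : R) (m : nat) : (0 < h)%R ->
  P [set w | (\sum_(j < k) j.+1 * N j h w)%N = m] =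
  (\sum_(x in Omega k m) \prod_(j < k) poisson_pmf (lambda j * h) (x j))%:E.
Proof.
move=> h0.
have -> : [set w | (\sum_(j < k) j.+1 * N j h w)%N = m] =
    \bigcup_(x in [set` Omega k m]) \bigcap_(j : 'I_k) (N j h @^-1` [set nat_of_ord (x j)]).
  apply/seteqP; split => w /=.
    move=> sm.
    have le j : (N j h w < m.+1)%N.
      rewrite ltnS -sm (bigD1 j)//= (leq_trans _ (leq_addr _ _))//.
      by rewrite leq_pmull.
    exists [ffun j => Ordinal (le j)]; last by move=> j _ /=; rewrite ffunE.
    rewrite /= inE -[X in _ == X]sm; apply/eqP/eq_bigr => j _.
    by rewrite ffunE.
  move=> [x]; rewrite /= inE => /eqP sx H.
  by transitivity (\sum_(j < k) j.+1 * x j)%N => //; apply: eq_bigr => j _; rewrite (H j).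
have disj : trivIset [set` Omega k m]
    (fun x => \bigcap_(j : 'I_k) (N j h @^-1` [set nat_of_ord (x j)])).
  apply/trivIsetP => x y _ _ /eqP xy; apply/seteqP; split => // w [/= wx wy].
  apply: xy; apply/ffunP => j; apply: val_inj => /=.
  by rewrite -(wx j)// -(wy j).
rewrite measure_fin_bigcup//; last first.
  move=> x _; apply: fin_bigcap_measurable => // j _.
  by apply: measurable_fun_fiber; apply: mN; exact: ltW.
have -> : [set` Omega k m] = [set` enum (Omega k m)].
  by apply/seteqP; split => x /=; rewrite mem_enum.
rewrite -fsbig_seq ?enum_uniq// big_enum/= -sumEFin.
apply: eq_bigr => x _; rewrite -prodEFin.
have /(_ (fun j => N j h @^-1` [set nat_of_ord (x j)])) :=
  indepN (J := [set: 'I_k]%SET).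
rewrite bigcap_finsetT => ->.
  under eq_bigl do rewrite inE.
  by apply: eq_bigr => j _; have [_ _ ->] := poisN j.
move=> j _; apply: (@measurable_fun_fiber _
    (g_sigma_algebraType (process_generator (N j))) _ [set nat_of_ord (x j)]).
by apply: measurable_process_generator; exact: ltW.
Qed.

End poisson_vector.

(** * Increments of the generalized counting process *)

(** Equality of finite-dimensional distributions speaks of the values of a process
    at given times; this turns an event on the increments of a nondecreasing
    sequence into one on its values, once the initial value is fixed. *)
Lemma increments_prefix_sumE (n c : nat) (G : nat -> nat) (x : 'I_n -> nat) :
  (forall i, G i <= G i.+1)%N ->
  ((forall i : 'I_n, (G i.+1 - G i)%N = x i) /\ G 0%N = c) <->
  (forall i : 'I_n.+1, G i = (c + \sum_(l < n | (l < i)%N) x l)%N).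
Proof.
move=> Gnd.
have step (i : 'I_n) : (\sum_(l < n | (l < i.+1)%N) x l =
    x i + \sum_(l < n | (l < i)%N) x l)%N.
  rewrite (bigD1 i)//=; congr addn; apply: eq_bigl => l.
  by rewrite ltnS [RHS]ltn_neqAle andbC.
split => [[Gx G0] [i /= ile]|Gs].
  elim: i ile => [_|i IH ilt]; first by rewrite big_pred0 ?addn0.
  have iln : (i < n)%N by [].
  rewrite (step (Ordinal iln)) addnCA -IH ?ltnS 1?ltnW//.
  by rewrite -(Gx (Ordinal iln)) subnK.
split => [i|]; last by rewrite (Gs ord0) big_pred0 ?addn0.
have := Gs (lift ord0 i); rewrite lift0 => ->.
have /= -> := Gs (widen_ord (leqnSn n) i).
by rewrite step addnCA addnK.
Qed.

Lemma bigcap_ord1 (T : Type) (A : set T) : \bigcap_(i : 'I_1) A = A.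
Proof. by apply/seteqP; split => w H; [exact: (H ord0)|move=> _ _]. Qed.

Section gcp_increments.
Local Open Scope ereal_scope.
Context d (T : measurableType d) (R : realType) (P : probability T R).
Variables (k : nat) (lambda : 'I_k -> R) (M : R -> T -> nat).
Hypothesis gcpM : generalized_counting_process P lambda M.

Lemma gcp_measurable t : (0 <= t)%R -> measurable_fun setT (M t).
Proof. by move=> t0; have [[mM _ _ _] _] := gcpM; exact: mM. Qed.

Lemma gcp_pmf (h : R) (m : nat) : (0 < h)%R ->
  P (M h @^-1` [set m]) =
  (\sum_(x in Omega k m) \prod_(j < k) poisson_pmf (lambda j * h) (x j))%:E.
Proof.
move=> h0; have [_ [d' [T' [P' [N [poisN indepN law]]]]]] := gcpM.
rewrite -(weighted_poisson_pmf poisN indepN)//.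
have := law 1%N (fun=> h) (fun=> [set m]) (fun=> ltW h0) (fun=> I).
by rewrite !bigcap_ord1.
Qed.

(** The event on increments is the disjoint union over the initial value of events
    on the values, which the counting process shares in law with the weighted sum
    of Poisson processes. For that sum, the increments are functions of the vector
    of Poisson increments. *)
Lemma gcp_increments (n : nat) (g : nat -> R) (A : 'I_n -> set nat) :
  (0 <= g 0%N)%R -> (forall i, g i <= g i.+1)%R ->
  P (\bigcap_(i : 'I_n) [set w | A i (M (g i.+1) w - M (g i) w)%N]) =
  \prod_(i < n) P [set w | A i (M (g i.+1 - g i)%R w)].
Proof.
move=> g0 gnd.
have gge0 i : (0 <= g i)%R.
  by elim: i => [//|i /le_trans]; apply; exact: gnd.
have [[mM M0 Mnd _] [d' [T' [P' [N [poisN indepN law]]]]]] := gcpM.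
pose M' t w := (\sum_(j < k) j.+1 * N j t w)%N.
have mN j t : (0 <= t)%R -> measurable_fun setT (N j t).
  by move=> t0; have [[mN _ _ _] _ _] := poisN j; exact: mN.
have Nnd j s t w : (0 <= s)%R -> (s <= t)%R -> (N j s w <= N j t w)%N.
  by have [[_ _ Nnd _] _ _] := poisN j; exact: Nnd.
have M'nd i w : (M' (g i) w <= M' (g i.+1) w)%N.
  by apply: leq_sum => j _; rewrite leq_mul2l Nnd.
have M'incr i w : (M' (g i.+1) w - M' (g i) w)%N =
    (\sum_(j < k) j.+1 * (N j (g i.+1) w - N j (g i) w))%N.
  rewrite /M' -sumnB; last by move=> j _; rewrite leq_mul2l Nnd.
  by apply: eq_bigr => j _; rewrite mulnBr.
have mM' t : (0 <= t)%R -> measurable_fun setT (M' t).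
  move=> t0 _ B _; rewrite setTI.
  pose V w : {ffun 'I_k -> nat} := [ffun j => N j t w].
  rewrite (_ : _ @^-1` _ = V @^-1` [set v | B (\sum_(j < k) j.+1 * v j)%N]).
    apply: measurable_countable_preimage => c.
    rewrite ffun_fiber.
    by apply: fin_bigcap_measurable => // j _; apply: measurable_fun_fiber; exact: mN.
  apply/seteqP; split => w /=; rewrite /M' => H; congr B: H; apply: eq_bigr => j _; by rewrite ffunE.
have law1 h m : (0 <= h)%R -> P (M h @^-1` [set m]) = P' (M' h @^-1` [set m]).
  move=> h0; have := law 1%N (fun=> h) (fun=> [set m]) (fun=> h0) (fun=> I).
  by rewrite !bigcap_ord1.
apply: (@product_law_of_points _ _ _ _ _ P P _ _
  (fun (i : 'I_n) w => (M (g i.+1) w - M (g i) w)%N)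
  (fun (i : 'I_n) w => M (g i.+1 - g i)%R w)).
- by move=> i c; apply: (@measurable_increment _ _ _ _ [set c]); exact: mM.
- by move=> i c; apply: measurable_fun_fiber; apply: mM; rewrite subr_ge0.
move=> x.
(* Summing over the value at [g 0] reduces the event to one on values. *)
transitivity (P' (\bigcap_(i : 'I_n) [set w | (M' (g i.+1) w - M' (g i) w)%N = x i])).
  rewrite -[X in P X](setIT) -[X in P' X]setIT -(preimage_setT (M (g 0%N))).
  rewrite -[X in P' (_ `&` X)](preimage_setT (M' (g 0%N))) -[RHS]mul1e.
  apply: (countable_preimage_measure_eq (k := 1%R)) => //.
  - by move=> c; apply: measurable_fun_fiber; exact: mM.
  - by move=> c; apply: measurable_fun_fiber; exact: mM'.
  - apply: fin_bigcap_measurable => // i _.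
    by apply: (@measurable_increment _ _ _ _ [set x i]); exact: mM.
  - apply: fin_bigcap_measurable => // i _.
    by apply: (@measurable_increment _ _ _ _ [set x i]); exact: mM'.
  move=> c; rewrite mul1e.
  have rect (S : Type) (G : R -> S -> nat) :
      (forall i w, (G (g i) w <= G (g i.+1) w)%N) ->
      (\bigcap_(i : 'I_n) [set w | (G (g i.+1) w - G (g i) w)%N = x i]) `&`
        G (g 0%N) @^-1` [set c] =
      \bigcap_(i : 'I_n.+1) (G (g i) @^-1` [set (c + \sum_(l < n | (l < i)%N) x l)%N]).
    move=> Gnd; apply/seteqP; split => w.
      move=> [Gx G0] i _.
      apply: (proj1 (@increments_prefix_sumE _ c (fun i => G (g i) w) x (fun i => Gnd i w))).
      by split => // l; exact: Gx.
    move=> H.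
    have [Gx G0] := proj2 (@increments_prefix_sumE _ c (fun i => G (g i) w) x
      (fun i => Gnd i w)) (fun i => H i I).
    by split => // i _; exact: Gx.
  rewrite !rect//; last by move=> i w; exact: Mnd.
  by apply: law => // i.
under eq_bigcapr => i _ do under eq_set do rewrite M'incr.
have := poisson_vector_increments poisN indepN
  (fun i : 'I_n => [set v : {ffun 'I_k -> nat} | (\sum_(j < k) j.+1 * v j)%N = x i]) g0 gnd.
rewrite (_ : \bigcap_i _ = \bigcap_(i : 'I_n) [set w |
  (\sum_(j < k) j.+1 * (N j (g i.+1) w - N j (g i) w))%N = x i]); last first.
  apply: eq_bigcapr => i _; apply/seteqP; split => w /= <-;
    by apply: eq_bigr => j _; rewrite ffunE.
move=> ->; apply: eq_bigr => i _; rewrite law1 ?subr_ge0//; congr (P' _).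
by apply/seteqP; split => w /= <-; apply: eq_bigr => j _; rewrite ffunE.
Qed.

End gcp_increments.

(** * Continuity in time of the marginal laws *)

Section gcp_marginal.
Context d (T : measurableType d) (R : realType) (P : probability T R).
Variables (k : nat) (lambda : 'I_k -> R) (M : R -> T -> nat).
Hypothesis lambda_gt0 : forall j, 0 < lambda j.
Hypothesis gcpM : generalized_counting_process P lambda M.
Let Lambda := \sum_(j < k) lambda j.

Let mM t : 0 <= t -> measurable_fun setT (M t).
Proof. exact: (gcp_measurable gcpM). Qed.

Lemma gcp_no_jump (h : R) : 0 <= h ->
  P (M h @^-1` [set 0%N]) = (expR (- (Lambda * h)))%:E.
Proof.
rewrite le_eqVlt => /predU1P[<-|h0].
  have [[_ M0 _ _] _] := gcpM.
  rewrite (_ : _ @^-1` _ = setT) ?probability_setT ?mulr0 ?oppr0 ?expR0//.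
  by apply/seteqP; split => w //= _; rewrite M0.
rewrite (gcp_pmf gcpM)//; congr EFin.
rewrite (bigD1 [ffun=> ord0])/=; last by rewrite inE big1// => j _; rewrite ffunE muln0.
rewrite [X in _ + X]big1 ?addr0; last first.
  move=> x /andP[_ /eqP]; case; apply/ffunP => j; rewrite ffunE.
  by apply: val_inj => /=; case: (x j) => -[].
rewrite mulr_suml -sumrN expR_sum; apply: eq_bigr => j _.
by rewrite ffunE /poisson_pmf mulr_gt0//= expr0 fact0 mul1r invr1 mul1r.
Qed.

(** This bounds the variation of all the marginal laws between [a] and [b] at once. *)
Lemma gcp_some_jump (a b : R) : 0 <= a -> a <= b ->
  P [set w | (M b w - M a w)%N != 0%N] = (1 - expR (- (Lambda * (b - a))))%:E.
Proof.
move=> a0 ab.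
have ba0 : 0 <= b - a by rewrite subr_ge0.
rewrite (_ : [set w | _] = ~` [set w | [set 0%N] (M b w - M a w)%N]); last first.
  by apply/seteqP; split => w /= /eqP.
rewrite probability_setC; last first.
  by apply: measurable_increment; apply: mM => //; exact: le_trans ab.
have := gcp_increments gcpM (n := 1%N) (g := fun i => if i is 0%N then a else b)
  (fun=> [set 0%N]) a0.
rewrite big_ord1 /= gcp_no_jump// => E.
rewrite EFinB; congr (_ - _)%E; rewrite -E; last by case.
by congr (P _); apply/seteqP; split => w H; [move=> i _; rewrite ord1|exact: (H ord0)].
Qed.

(** The absolute value extends the law of [M h] to all real [h], so that it is a
    continuous function on the line. *)
Definition gcp_marginal (A : set nat) (h : R) : R := fine (P (M `|h| @^-1` A)).

Lemma gcp_marginal_ge0 A h : 0 <= gcp_marginal A h.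
Proof. exact: fine_ge0. Qed.

Lemma gcp_marginalE A h : 0 <= h -> (gcp_marginal A h)%:E = P (M h @^-1` A).
Proof.
move=> h0; rewrite /gcp_marginal ger0_norm// fineK// fin_num_measure//.
by apply: measurable_fun_fiber; exact: mM.
Qed.

Lemma gcp_marginal_le1 A h : gcp_marginal A h <= 1.
Proof.
rewrite -lee_fin /gcp_marginal.
have mA : measurable (M `|h| @^-1` A) by apply: measurable_fun_fiber; exact: mM.
by rewrite fineK ?fin_num_measure// probability_le1.
Qed.

Lemma gcp_marginal_setT h : gcp_marginal setT h = 1.
Proof. by rewrite /gcp_marginal preimage_setT probability_setT. Qed.

(** The laws of [M a] and [M b] differ by at most the probability that [M] moves
    between [a] and [b], that is [1 - exp(- Lambda (b - a)) <= Lambda (b - a)]. *)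
Lemma gcp_marginal_lip A a b :
  `|gcp_marginal A a - gcp_marginal A b| <= Lambda * `|a - b|.
Proof.
suff H x y : 0 <= x -> x <= y ->
    `|gcp_marginal A x - gcp_marginal A y| <= Lambda * (y - x).
  have Lge0 : 0 <= Lambda by apply: sumr_ge0 => j _; exact: ltW.
  have E h : gcp_marginal A h = gcp_marginal A `|h| by rewrite /gcp_marginal normr_id.
  rewrite (E a) (E b); apply: (@le_trans _ _ (Lambda * `| `|a| - `|b| |)).
    have [ab|ba] := leP `|a| `|b|.
      by rewrite [X in _ <= _ * X]distrC [X in _ <= _ * X]ger0_norm ?subr_ge0//; exact: H.
    rewrite [X in _ <= _ * X]ger0_norm ?subr_ge0; last exact: ltW.
    rewrite distrC; by apply: H => //; exact: ltW.
  by rewrite ler_wpM2l// ler_dist_dist.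
move=> x0 xy; have y0 := le_trans x0 xy.
have mD : measurable [set w | (M y w - M x w)%N != 0%N].
  by apply: (@measurable_increment _ _ _ _ [set m | m != 0%N]); exact: mM.
have [[_ _ Mnd _] _] := gcpM.
have E w : ~~ ((M y w - M x w)%N != 0%N) -> M y w = M x w.
  rewrite negbK subn_eq0 => yx; apply/eqP; rewrite eqn_leq yx /=.
  exact: Mnd.
have mA t : 0 <= t -> measurable (M t @^-1` A).
  by move=> t0; apply: measurable_fun_fiber; exact: mM.
have PD : (P [set w | (M y w - M x w)%N != 0%N] <= (Lambda * (y - x))%:E)%E.
  rewrite gcp_some_jump// lee_fin lerBlDr -lerBlDl.
  by have := expR_ge1Dx (- (Lambda * (y - x))).
have bound s t : 0 <= s -> 0 <= t -> (forall w, ~~ ((M y w - M x w)%N != 0%N) -> M s w = M t w) ->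
    gcp_marginal A s - gcp_marginal A t <= Lambda * (y - x).
  move=> s0 t0 st; rewrite lerBlDl -lee_fin EFinD !gcp_marginalE//.
  apply: le_trans (leeD2l _ PD).
  apply: (@le_trans _ _ (P ((M t @^-1` A) `|`
      [set w | (M y w - M x w)%N != 0%N]))); last exact: measureU2 (mA _ t0) mD.
  apply: le_measure; rewrite ?inE; [exact: mA|by apply: measurableU => //; exact: mA|].
  move=> w /= Aw; case: (boolP ((M y w - M x w)%N != 0%N)) => [|/st Ew]; first by right.
  by left; rewrite -Ew.
rewrite ler_norml bound// ?andbT; last by move=> w /E.
by rewrite lerNl opprB bound.
Qed.

Lemma continuous_gcp_marginal A : continuous (gcp_marginal A).
Proof.
move=> x; apply/cvgrPdist_le => e e0.
have Lge0 : 0 <= Lambda by apply: sumr_ge0 => j _; exact: ltW.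
have L1 : 0 < Lambda + 1 by rewrite ltr_wpDl.
near=> y; apply: (le_trans (gcp_marginal_lip A x y)).
apply: (@le_trans _ _ ((Lambda + 1) * `|x - y|)); first by rewrite ler_wpM2r// lerDl.
rewrite -ler_pdivlMl//; near: y.
apply: (@cvgr_dist_le _ _ _ (nbhs x) _ id x); first exact: cvg_id.
by apply: mulr_gt0 => //; rewrite invr_gt0.
Unshelve. all: by end_near. Qed.

Lemma measurable_gcp_marginal A : measurable_fun setT (gcp_marginal A).
Proof. by apply: continuous_measurable_fun; exact: continuous_gcp_marginal. Qed.

End gcp_marginal.

(** * Counting process at independent random times *)

Section bounded_convergence.
Context d (T : measurableType d) (R : realType) (P : probability T R).

Lemma bounded_cvg_integral (f_ : nat -> T -> R) (f : T -> R) :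
  (forall n, measurable_fun setT (f_ n)) -> (forall n x, `|f_ n x| <= 1) ->
  (forall x, f_ n x @[n --> \oo] --> f x) ->
  ((\int[P]_x (f_ n x)%:E)%E @[n --> \oo] --> (\int[P]_x (f x)%:E)%E).
Proof.
move=> mf f1 ff; apply: (@dominated_cvg _ _ _ P setT measurableT
  (fun n x => (f_ n x)%:E) (fun x => (f x)%:E) (cst 1%E)) => //.
- by move=> n; exact/measurable_EFinP.
- by move=> x _; apply: cvg_EFin; [exact: nearW|exact: ff].
- exact: finite_measure_integrable_cst.
- by move=> n x _; rewrite lee_fin.
Qed.

End bounded_convergence.

Section freezing.
Local Open Scope ereal_scope.
Context d (T : measurableType d) (R : realType) (P : probability T R).

(** Conditioning on a countably valued [L] independent of the events [B c]: on each
    fibre of [L] both sides are the same product of probabilities. *)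
Lemma freezing (F G : set (set T)) (C : countType) (L : T -> C) (B : C -> set T) :
  independent2 P F G -> F `<=` measurable -> G `<=` measurable ->
  (forall c, F (B c)) -> (forall c, G (L @^-1` [set c])) ->
  measurable [set w | B (L w) w] /\
  P [set w | B (L w) w] = \int[P]_w P (B (L w)).
Proof.
move=> indep Fm Gm FB GL.
pose D n := if pickle_inv n is Some c then L @^-1` [set c] else set0.
have mD n : measurable (D n).
  by rewrite /D; case: pickle_inv => // c; exact/Gm/GL.
have UD : \bigcup_n D n = setT.
  by apply/seteqP; split => w // _; exists (pickle (L w)) => //; rewrite /D pickleK_inv.
have tD : trivIset setT D.
  apply/trivIsetP => i j _ _; apply: contra_neqP => /eqP/set0P[w []]; rewrite /D.
  case ei: (pickle_inv i) => [c|//]; case ej: (pickle_inv j) => [c'|//] /= Lc Lc'.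
  have := @pickle_invK C i; have := @pickle_invK C j.
  by rewrite ei ej /= -Lc -Lc' => <- <-.
have mE : measurable [set w | B (L w) w].
  rewrite (_ : mkset _ = \bigcup_n (if pickle_inv n is Some c then
      B c `&` L @^-1` [set c] else set0)).
    apply: bigcup_measurable => n _; case: pickle_inv => [c|//].
    by apply: measurableI; [exact/Fm/FB|exact/Gm/GL].
  apply/seteqP; split => [w /= Bw|w [n _]].
    by exists (pickle (L w)) => //; rewrite pickleK_inv.
  by case: pickle_inv => // c [Bw /= Lw]; rewrite Lw.
split=> //.
have mPB : measurable_fun setT (fun w => P (B (L w))).
  move=> _ S _; rewrite setTI.
  rewrite (_ : _ @^-1` _ = L @^-1` [set c | S (P (B c))])//.
  by apply: measurable_countable_preimage => c; exact/Gm/GL.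
transitivity (\int[P]_w (\1_[set w | B (L w) w] w : R)%:E).
  by rewrite integral_indic// setIT.
have split_D (f : T -> \bar R) : measurable_fun setT f -> (forall x, 0 <= f x) ->
    \int[P]_x f x = \sum_(n <oo) \int[P]_(x in D n) f x.
  by move=> mf f0; rewrite -[in LHS]UD ge0_integral_bigcup//=; rewrite UD.
rewrite !split_D//; last exact/measurable_EFinP.
apply: eq_eseriesr => n _; rewrite integral_indic//.
rewrite /D; case: pickle_inv => [c|]; last by rewrite setI0 measure0 integral_set0.
rewrite (_ : _ `&` _ = B c `&` L @^-1` [set c]); last first.
  by apply/seteqP; split => w [/= + Lw]; rewrite Lw.
transitivity (P (B c) * P (L @^-1` [set c])); first exact: indep.
rewrite (eq_integral (fun=> P (B c))); last first.
  by move=> w /[!inE] /= ->.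
by rewrite integral_cst//; exact/Gm/GL.
Qed.

End freezing.

Section time_change.
Context d (T : measurableType d) (R : realType) (P : probability T R).
Variables (k : nat) (lambda : 'I_k -> R) (M : R -> T -> nat).
Hypothesis lambda_gt0 : forall j, 0 < lambda j.
Hypothesis gcpM : generalized_counting_process P lambda M.
Variable GY : set (set T).
Hypothesis indep : independent2 P (process_sigma M) <<s GY>>.
Hypothesis GYm : <<s GY>> `<=` measurable.
Variable U : nat -> T -> R.
Hypothesis mU : forall i, measurable_fun [set: g_sigma_algebraType GY] (U i).
Hypothesis U0 : forall w, 0 <= U 0%N w.
Hypothesis Und : forall i w, U i w <= U i.+1 w.

Let Uge0 i w : 0 <= U i w.
Proof. by elim: i => [//|i /le_trans]; apply. Qed.

(** The successor makes the grid point strictly larger than [x], which is needed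
    because paths are only assumed to be locally constant on the right. *)
Definition upper_grid (N : nat) (x : R) : R :=
  (Num.truncn (N.+1%:R * x)).+1%:R / N.+1%:R.

Lemma upper_grid_gt N x : 0 <= x -> x < upper_grid N x.
Proof.
move=> x0; rewrite /upper_grid ltr_pdivlMr// mulrC.
have Nx : 0 <= N.+1%:R * x by exact: mulr_ge0.
by have /andP[] := truncn_itv Nx.
Qed.

Lemma upper_grid_le N x : 0 <= x -> upper_grid N x <= x + N.+1%:R^-1.
Proof.
move=> x0; rewrite /upper_grid -natr1 mulrDl mul1r lerD2r ler_pdivrMr// mulrC.
by rewrite truncn_le mulr_ge0.
Qed.

Lemma upper_grid_nd N x y : x <= y -> upper_grid N x <= upper_grid N y.
Proof.
move=> xy; rewrite /upper_grid ler_pM2r ?invr_gt0// ler_nat ltnS.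
by apply: le_truncn; rewrite ler_pM2l.
Qed.

Lemma cvg_upper_grid x : 0 <= x -> upper_grid N x @[N --> \oo] --> x.
Proof.
move=> x0; apply: (@squeeze_cvgr _ _ _ _ (cst x) (fun N => x + N.+1%:R^-1)).
- by apply: nearW => N; rewrite upper_grid_le// (ltW (upper_grid_gt _ _)).
- exact: cvg_cst.
- by rewrite -[X in _ --> X]addr0; apply: cvgD; [exact: cvg_cst|exact: cvg_harmonic].
Qed.

Lemma upper_grid_stationary (x : R) w : 0 <= x ->
  \forall N \near \oo, M (upper_grid N x) w = M x w.
Proof.
move=> x0; have [[_ _ _ /(_ x w x0) Mr] _] := gcpM.
have : \forall s \near x^'+, M s w = M x w by [].
rewrite near_withinE => /nbhs_ballP[e /= e0 xe].
have := cvg_upper_grid x0 => /cvgrPdist_lt/(_ e e0).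
apply: filterS => N xN; apply: xe; first exact: xN.
exact: upper_grid_gt.
Qed.

Lemma measurable_upper_grid d' (S : measurableType d') (f : S -> R) N :
  measurable_fun setT f -> measurable_fun setT (fun x => upper_grid N (f x)).
Proof.
move=> mf; apply: (measurableT_comp _ mf).
by apply: nondecreasing_measurable => // x y; exact: upper_grid_nd.
Qed.

Section at_level.
Variables (n : nat) (A : 'I_n -> set nat).

Let Lgrid N w : {ffun 'I_n.+1 -> nat} :=
  [ffun i => Num.truncn (N.+1%:R * U (nat_of_ord i) w)].

(** Constant beyond [n], as [gcp_increments] takes an infinite sequence of times. *)
Let grid (N : nat) (c : {ffun 'I_n.+1 -> nat}) (i : nat) : R :=
  (c (inord (minn i n))).+1%:R / N.+1%:R.

Let gridE N w i : grid N (Lgrid N w) i = upper_grid N (U (minn i n) w).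
Proof. by rewrite /grid /Lgrid ffunE inordK ?ltnS ?geq_minr. Qed.

Let time_changed_grid N :
  measurable [set w | forall i : 'I_n,
     A i (M (upper_grid N (U i.+1 w)) w - M (upper_grid N (U i w)) w)%N] /\
  P [set w | forall i : 'I_n,
     A i (M (upper_grid N (U i.+1 w)) w - M (upper_grid N (U i w)) w)%N] =
  (\int[P]_w (\prod_(i < n) gcp_marginal P M (A i)
     (upper_grid N (U i.+1 w) - upper_grid N (U i w)))%:E)%E.
Proof.
have mM t : 0 <= t -> measurable_fun setT (M t) by exact: (gcp_measurable gcpM).
pose B c := \bigcap_(i : 'I_n) [set w | A i (M (grid N c i.+1) w - M (grid N c i) w)%N].
have := @freezing _ _ _ P (process_sigma M) <<s GY>> _ (Lgrid N) B indep
  (process_sigma_sub mM) GYm.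
have -> : [set w | B (Lgrid N w) w] = [set w | forall i : 'I_n,
     A i (M (upper_grid N (U i.+1 w)) w - M (upper_grid N (U i w)) w)%N].
  apply/seteqP; split => w; rewrite /B /=.
    move=> H i; have := H i I; rewrite /= !gridE (minn_idPl _)// (minn_idPl _)//.
    exact: ltnW.
  move=> H i _; have := H i; rewrite /= !gridE (minn_idPl _)// (minn_idPl _)//.
  exact: ltnW.
case.
- move=> c; apply: (@fin_bigcap_measurable _
    (g_sigma_algebraType (process_generator M))) => // i _.
  by apply: (@measurable_increment _ (g_sigma_algebraType (process_generator M)));
     apply: measurable_process_generator; rewrite /grid divr_ge0.
- move=> c.
  rewrite (_ : _ @^-1` _ = \bigcap_(i : 'I_n.+1)
      (U i @^-1` [set x | upper_grid N x = (c i).+1%:R / N.+1%:R])).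
    apply: (@fin_bigcap_measurable _ (g_sigma_algebraType GY)) => // i _.
    have := @measurable_upper_grid _ (g_sigma_algebraType GY) _ N (mU i) measurableT
      [set (c i).+1%:R / N.+1%:R] (measurable_set1 _).
    by rewrite setTI.
  have inj (a b : nat) : a.+1%:R / N.+1%:R = b.+1%:R / N.+1%:R :> R -> a = b.
    by move=> /divIf => /(_ _)/eqP; rewrite pnatr_eq0 eqr_nat => /(_ isT) /eqP[].
  apply/seteqP; split => w /=.
    by move=> <- i _ /=; rewrite ffunE.
  by move=> H; apply/ffunP => i; rewrite ffunE; apply: inj; exact: (H i).
move=> mE ->; split=> //; apply: eq_integral => w _.
rewrite (gcp_increments gcpM); last 2 first.
- by rewrite /grid divr_ge0.
- move=> i; rewrite !gridE; apply: upper_grid_nd.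
  have [ni|ni] := leqP n i; first by rewrite (minn_idPr _)// 1?ltnW// (minn_idPr _).
  by rewrite (minn_idPl _)// (minn_idPl _)// ltnW.
rewrite -prodEFin; apply: eq_bigr => i _.
rewrite !gridE (minn_idPl _)// (minn_idPl _)//; last exact: ltnW.
by rewrite (gcp_marginalE gcpM)// subr_ge0 upper_grid_nd.
Qed.

(** Both sides are limits of their analogues for the grid-valued times
    [upper_grid N (U i)]: the indicator of the event is eventually constant in [N]
    for each outcome, and the integrand on the right is continuous in the times. *)
Lemma time_changed_increments :
  measurable [set w | forall i : 'I_n, A i (M (U i.+1 w) w - M (U i w) w)%N] /\
  P [set w | forall i : 'I_n, A i (M (U i.+1 w) w - M (U i w) w)%N] =
  (\int[P]_w (\prod_(i < n) gcp_marginal P M (A i) (U i.+1 w - U i w))%:E)%E.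
Proof.
set E := [set w | _].
pose EN N := [set w | forall i : 'I_n,
     A i (M (upper_grid N (U i.+1 w)) w - M (upper_grid N (U i w)) w)%N].
have mEN N : measurable (EN N) by exact: (time_changed_grid N).1.
have cvgE w : (\1_(EN N) w : R) @[N --> \oo] --> (\1_E w : R).
  apply: cvg_near_cst.
  have : \forall N \near \oo, forall i : 'I_n.+1, M (upper_grid N (U i w)) w = M (U i w) w.
    by apply: filter_forall => i; exact: upper_grid_stationary.
  apply: filterS => N H.
  have EE : EN N w <-> E w.
    split=> EE i; have := EE i;
      by rewrite (H (widen_ord (leqnSn n) i)) -(lift0 i) (H (lift ord0 i)).
  rewrite !indicE; congr (nat_of_bool _)%:R.
  by apply/idP/idP => /set_mem/EE ?; exact/mem_set.
have mE : measurable E.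
  have mi : measurable_fun setT (\1_E : T -> R).
    by apply: (@measurable_fun_cvg _ _ _ _ (fun N => \1_(EN N))).
  have := mi measurableT [set 1] (measurable_set1 _); rewrite setTI.
  congr measurable; apply/seteqP; split => w /=; rewrite indicE.
    by case: (boolP (w \in E)) => [/set_mem//|_ /eqP]; rewrite eq_sym oner_eq0.
  by move=> Ew; rewrite mem_set.
split=> //.
have mU' i : measurable_fun setT (U i).
  move=> _ B mB; rewrite setTI; apply: GYm.
  by have := @mU i measurableT B mB; rewrite setTI.
have cE : (P (EN N) @[N --> \oo] --> P E)%E.
  rewrite -[X in _ --> P X]setIT -integral_indic//.
  under eq_fun do rewrite -[X in P X]setIT -integral_indic//.
  apply: (bounded_cvg_integral (f_ := fun N => \1_(EN N))) => // N w.
  by rewrite indicE; case: (w \in _); rewrite ?normr1 ?normr0.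
have PEN : (fun N => P (EN N)) = (fun N => \int[P]_w (\prod_(i < n)
    gcp_marginal P M (A i) (upper_grid N (U i.+1 w) - upper_grid N (U i w)))%:E)%E.
  by apply/funext => N; exact: (time_changed_grid N).2.
rewrite PEN in cE; apply: (cvg_unique _ cE) => //.
apply: bounded_cvg_integral.
- move=> N; apply: measurable_prod => i _.
  apply: measurableT_comp; first exact: (measurable_gcp_marginal lambda_gt0 gcpM).
  by apply: measurable_funB; exact: measurable_upper_grid.
- move=> N w; rewrite ger0_norm; last by apply: prodr_ge0 => i _; exact: gcp_marginal_ge0.
  by apply: prodr_ile1 => i; rewrite gcp_marginal_ge0 (gcp_marginal_le1 gcpM).
- move=> w; apply: cvg_big => [|i _]; first exact: mul_continuous.
  apply: continuous_cvg; first exact: (continuous_gcp_marginal lambda_gt0 gcpM).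
  by apply: cvgB; exact: cvg_upper_grid.
Qed.

End at_level.
End time_change.

(** * The subordinated process is a Levy process *)

Section subordinated_process.
Context d (T : measurableType d) (R : realType) (P : probability T R).
Variables (k : nat) (lambda : 'I_k -> R) (M : R -> T -> nat) (Y : R -> T -> R).
Hypothesis lambda_gt0 : forall j, 0 < lambda j.
Hypothesis gcpM : generalized_counting_process P lambda M.
Hypothesis subY : subordinator P Y.
Hypothesis indep : independent2 P (process_sigma M) (process_sigma Y).

Let mY t : 0 <= t -> measurable_fun setT (Y t).
Proof. by move=> t0; have [[mY _ _ _ _] _ _] := subY; exact: mY. Qed.

Let mM t : 0 <= t -> measurable_fun setT (M t).
Proof. exact: (gcp_measurable gcpM). Qed.

Let Yge0 t w : 0 <= t -> 0 <= Y t w.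
Proof. by have [_ Y0 _] := subY; exact: Y0. Qed.

Let Ynd s t w : 0 <= s -> s <= t -> Y s w <= Y t w.
Proof. by have [_ _ Ynd] := subY; exact: Ynd. Qed.

Let Mnd s t w : 0 <= s -> s <= t -> (M s w <= M t w)%N.
Proof. by have [[_ _ Mnd _] _] := gcpM; exact: Mnd. Qed.

Let Ysub : process_sigma Y `<=` measurable.
Proof. exact: process_sigma_sub. Qed.

Let mphi A : measurable_fun setT (gcp_marginal P M A).
Proof. exact: (measurable_gcp_marginal lambda_gt0 gcpM). Qed.

(** The formula for random times, between the constant time 0 and [Y t]. *)
Lemma subordinated_marginal (t : R) (A : set nat) : 0 <= t ->
  measurable [set w | A (M (Y t w) w)] /\
  P [set w | A (M (Y t w) w)] = (\int[P]_w (gcp_marginal P M A (Y t w))%:E)%E.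
Proof.
(* [M] vanishes at time 0, so its increment from 0 to [Y t] is its value. *)
move=> t0; pose U i w := if i is 0%N then 0 else Y t w.
have mU i : measurable_fun [set: g_sigma_algebraType (process_generator Y)] (U i).
  case: i => [|i]; first exact: measurable_cst.
  exact: measurable_process_generator.
have := @time_changed_increments _ _ _ P _ _ _ lambda_gt0 gcpM _ indep Ysub U mU
  (fun=> lexx 0) _ 1%N (fun=> A).
have [[_ M0 _ _] _] := gcpM.
have -> : [set w | forall i : 'I_1, A (M (U i.+1 w) w - M (U i w) w)%N] =
    [set w | A (M (Y t w) w)].
  apply/seteqP; split => w /=.
    by move/(_ ord0); rewrite /U/= M0 subn0.
  by move=> Aw i; rewrite ord1 /U/= M0 subn0.
case.
  by case => [|i] w //=; exact: Yge0.
move=> mA ->; split => //; apply: eq_integral => w _.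
by rewrite big_ord1 /U/= subr0.
Qed.

Lemma subordinated_increments (n : nat) (t : nat -> R) (A : 'I_n -> set nat) :
  0 <= t 0%N -> (forall i, t i <= t i.+1) ->
  P [set w | forall i : 'I_n, A i (M (Y (t i.+1) w) w - M (Y (t i) w) w)%N] =
  (\prod_(i < n) \int[P]_w (gcp_marginal P M (A i) (Y (t i.+1) w - Y (t i) w))%:E)%E.
Proof.
move=> t0 tnd.
have tge0 i : 0 <= t i by elim: i => [//|i /le_trans]; apply; exact: tnd.
have mU i : measurable_fun [set: g_sigma_algebraType (process_generator Y)] (Y (t i)).
  exact: measurable_process_generator.
rewrite (@time_changed_increments _ _ _ P _ _ _ lambda_gt0 gcpM _ indep Ysub
  (fun i => Y (t i)) mU _ _ n A).2; last 2 first.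
- by move=> w; exact: Yge0.
- by move=> i w; exact: Ynd.
apply: (@integral_prod_independent _ _ _ _ _ P _
  (fun (i : 'I_n) w => Y (t i.+1) w - Y (t i) w) (fun i => gcp_marginal P M (A i))).
- by move=> i; apply: measurable_funB; exact: mY.
- move=> B mB; have [[_ _ indY _ _] _ _] := subY.
  have := indY n t t0 tnd [set: 'I_n]%SET
    (fun i => (fun w => Y (t i.+1) w - Y (t i) w) @^-1` B i).
  rewrite bigcap_finsetT => ->; last by move=> i _; exists (B i).
  by under eq_bigl do rewrite inE.
- by move=> i; exact: mphi.
- by move=> i x; rewrite gcp_marginal_ge0 (gcp_marginal_le1 gcpM).
Qed.

Lemma subordinated_increment (s t : R) (A : set nat) : 0 <= s -> s <= t ->
  P [set w | A (M (Y t w) w - M (Y s w) w)%N] =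
  (\int[P]_w (gcp_marginal P M A (Y t w - Y s w))%:E)%E.
Proof.
move=> s0 st.
have := @subordinated_increments 1%N (fun i => if i is 0%N then s else t)
  (fun=> A) s0; rewrite big_ord1 /= => <-; last by case.
congr (P _); apply/seteqP; split => w /= H; first by move=> i; rewrite ord1.
exact: (H ord0).
Qed.

Let Z t w : R := (M (Y t w) w)%:R.

Let Zincr s t w : 0 <= s -> s <= t ->
  Z t w - Z s w = (M (Y t w) w - M (Y s w) w)%N%:R.
Proof. by move=> s0 st; rewrite /Z natrB// Mnd ?Yge0// Ynd. Qed.

Lemma measurable_subordinated t : 0 <= t -> measurable_fun setT (Z t).
Proof.
move=> t0 _ B mB; rewrite setTI.
exact: (subordinated_marginal [set m | B m%:R] t0).1.
Qed.

Lemma subordinated_independent_increments : independent_increments P Z.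
Proof.
move=> n t t0 tnd J B BJ.
have tge0 i : 0 <= t i by elim: i => [//|i /le_trans]; apply; exact: tnd.
have /choice[C CP] (i : 'I_n) : exists C : set R, i \in J ->
    (fun w => Z (t i.+1) w - Z (t i) w) @^-1` C = B i.
  have [iJ|_] := boolP (i \in J); last by exists set0.
  by have [C mC <-] := BJ i iJ; exists C.
(* Increments outside [J] are left unconstrained and contribute a factor 1. *)
pose A (i : 'I_n) : set nat := if i \in J then [set m | C i m%:R] else setT.
have BE i : i \in J -> B i = [set w | A i (M (Y (t i.+1) w) w - M (Y (t i) w) w)%N].
  move=> iJ; rewrite -CP// /A iJ; apply/seteqP; split => w /=; by rewrite Zincr.
transitivity (P [set w | forall i : 'I_n, A i (M (Y (t i.+1) w) w - M (Y (t i) w) w)%N]).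
  congr (P _); apply/seteqP; split => w /= H i.
    rewrite /A; case: ifPn => // iJ; have := H i iJ; rewrite BE// /A iJ; exact.
  by move=> iJ; rewrite BE//; exact: H.
rewrite subordinated_increments// (bigID (fun i => i \in J))/=.
rewrite [X in (_ * X)%E]big1 ?mule1; last first.
  move=> i /negbTE iJ; rewrite /A iJ.
  under eq_integral do rewrite gcp_marginal_setT.
  by rewrite integral_cst//= probability_setT mule1.
by apply: eq_bigr => i iJ; rewrite BE// subordinated_increment.
Qed.

Lemma subordinated_stationary_increments : stationary_increments P Z.
Proof.
move=> s h s0 h0 B mB; pose A : set nat := [set m | B m%:R].
have E a b : 0 <= a -> a <= b ->
    (fun w => Z b w - Z a w) @^-1` B = [set w | A (M (Y b w) w - M (Y a w) w)%N].
  by move=> a0 ab; apply/seteqP; split => w /=; rewrite Zincr.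
rewrite !E ?lerDl// !subordinated_increment ?lerDl//.
have [[_ _ _ statY _] _ _] := subY.
under eq_integral do rewrite -[gcp_marginal _ _ _ _]mul1r.
under [RHS]eq_integral do rewrite -[gcp_marginal _ _ _ _]mul1r.
have mX a b : 0 <= a -> 0 <= b -> measurable_fun setT (fun w => Y b w - Y a w).
  by move=> a0 b0; apply: measurable_funB; exact: mY.
apply: (@integral_transfer _ _ _ _ _ _ _ P P (fun=> 1)
  (fun w => Y (s + h) w - Y s w) (fun=> 1)
  (fun w => Y h w - Y 0 w) (gcp_marginal P M A)) => //.
- by apply: mX => //; exact: addr_ge0.
- exact: mX.
- move=> C mC; under eq_integral do rewrite mul1r.
  under [RHS]eq_integral do rewrite mul1r.
  rewrite !integral_indic_comp//; first exact: statY.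
  - exact: mX.
  - by apply: mX => //; exact: addr_ge0.
- by move=> x; exact: gcp_marginal_ge0.
Qed.

(** From the right, [Y s] decreases to [Y t], near which [M] is constant on the
    right. From the left, [M (Y s)] is a bounded nondecreasing function of [s] with
    integer values, hence eventually constant. *)
Lemma subordinated_cadlag w : cadlag (Z ^~ w).
Proof.
have [[_ _ _ _ /(_ w)[Yr Yl]] _ _] := subY.
have [[_ _ _ Mr] _] := gcpM; split => t t0.
  have := Mr (Y t w) w (Yge0 _ t0); rewrite near_withinE => /nbhs_ballP[e /= e0 Me].
  apply: cvg_near_cst; have /cvgrPdist_lt/(_ e e0) := Yr t t0.
  rewrite !near_withinE; apply: filterS => s + ts => /(_ ts) Yse.
  rewrite /Z; congr (_%:R).
  have := Ynd w t0 (ltW ts); rewrite le_eqVlt => /predU1P[->//|Yts].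
  exact: Me.
(* The largest value before [t] is attained at some [s], and then kept up to [t]. *)
pose Q m := `[<exists s, [/\ 0 <= s, s < t & M (Y s w) w = m]>].
have Q0 : exists m, Q m.
  by exists (M (Y 0 w) w); apply/asboolP; exists 0.
have Qle m : Q m -> (m <= M (Y t w) w)%N.
  move=> /asboolP[s [s0 st <-]]; apply: Mnd; first exact: Yge0.
  exact/Ynd/ltW.
have [m /asboolP[s [s0 st <-]] mmax] := ex_maxnP Q0 Qle.
apply/cvg_ex; exists (Z s w); apply: cvg_near_cst.
near=> r; rewrite /Z; congr (_%:R).
have sr : s < r by near: r; exact: nbhs_left_gt.
have rt : r < t by near: r; exact: nbhs_left_lt.
apply/eqP; rewrite eqn_leq mmax/=; last by apply/asboolP; exists r; rewrite (le_trans s0 (ltW sr)).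
by apply: Mnd; [exact: Yge0|exact/Ynd/ltW].
Unshelve. all: by end_near. Qed.

Lemma subordinated_levy : levy_process P Z.
Proof.
split.
- exact: measurable_subordinated.
- have [[_ Y0 _ _ _] _ _] := subY; have [[_ M0 _ _] _] := gcpM.
  by move: Y0; apply: filterS => w Yw; rewrite /Z Yw M0.
- exact: subordinated_independent_increments.
- exact: subordinated_stationary_increments.
- exact: subordinated_cadlag.
Qed.

End subordinated_process.

(** * Gamma integrals at half-integers *)

Section gamma_integrals.
Context {R : realType}.
Local Notation mu := (@lebesgue_measure R).

Lemma itv_oy_bigcup (c : R) : 0 < c ->
  `]0, +oo[%classic = \bigcup_n `[c / n.+1%:R, +oo[%classic.
Proof.
move=> c0; apply/seteqP; split => [x|x [n _]]; rewrite /= !in_itv/= !andbT.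
  move=> x0; exists (Num.truncn (c / x)) => //=.
  rewrite in_itv/= andbT ler_pdivrMr// mulrC -ler_pdivrMr//.
  by rewrite ltW//; have /andP[] := truncn_itv (divr_ge0 (ltW c0) (ltW x0)).
by apply: lt_le_trans; rewrite divr_gt0.
Qed.

(** The integrands used below are singular at 0, while substitution and the
    fundamental theorem of calculus are available on closed half-lines. *)
Lemma cvg_integral_oy (c : R) (f : R -> R) : 0 < c ->
  measurable_fun setT f -> (forall x, 0 < x -> 0 <= f x) ->
  (\int[mu]_(x in `[(c / n.+1%:R)%R, +oo[) (f x)%:E)%E @[n --> \oo] -->
  (\int[mu]_(x in `]0%R, +oo[) (f x)%:E)%E.
Proof.
move=> c0 mf f0; rewrite (itv_oy_bigcup c0).
have sub n : [set` `[c / n.+1%:R, +oo[] `<=` [set` `]0, +oo[].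
  by move=> x; rewrite (itv_oy_bigcup c0) => xn; exists n.
apply: ge0_nondecreasing_set_cvg_integral => //.
- move=> m n mn; apply/subsetPset => x; rewrite /= !in_itv/= !andbT.
  apply: le_trans; rewrite ler_pM2l// lef_pV2 ?posrE// ler_nat ltnS//.
- by move=> n; apply/measurable_EFinP; exact: measurable_funTS.
- by move=> n x /sub; rewrite /= in_itv/= andbT lee_fin => /f0.
Qed.

Lemma integral_oy_scale (b : R) (f : R -> R) : 0 < b ->
  (forall x, 0 < x -> {for x, continuous f}) -> (forall x, 0 < x -> 0 <= f x) ->
  measurable_fun setT f ->
  (\int[mu]_(x in `]0%R, +oo[) (f x)%:E =
   \int[mu]_(x in `]0%R, +oo[) (f (b * x) * b)%:E)%E.
Proof.
move=> b0 cf f0 mf.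
have L := cvg_integral_oy b0 mf f0.
have mfb : measurable_fun setT (fun x => f (b * x) * b).
  apply: measurable_funM => //.
  by apply: measurableT_comp => //; exact: measurable_funM.
have fb0 x : 0 < x -> 0 <= f (b * x) * b.
  by move=> x0; rewrite mulr_ge0 ?f0 ?mulr_gt0// ltW.
have := cvg_integral_oy ltr01 mfb fb0.
suff -> : (fun n => \int[mu]_(x in `[(1 / n.+1%:R)%R, +oo[) (f (b * x) * b)%:E)%E =
    (fun n => \int[mu]_(x in `[(b / n.+1%:R)%R, +oo[) (f x)%:E)%E.
  by move=> /(cvg_unique _ L); apply.
apply/funext => n; set a := 1 / n.+1%:R.
have a0 : 0 < a by rewrite divr_gt0.
have -> : b / n.+1%:R = b * a by rewrite /a div1r.
have dF : (( *%R b : R -> R)^`())%classic = cst b.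
  by apply/funext => x; rewrite derive1E derive_val -[LHS]/(b * 1) mulr1.
rewrite (@increasing_ge0_integration_by_substitutiony _ ( *%R b) f a).
- by apply: eq_integral => x _; rewrite /= dF.
- by move=> x y _ _ xy; rewrite ltr_pM2l.
- by rewrite dF => x _; exact: cst_continuous.
- by rewrite dF; exact: is_cvg_cst.
- by rewrite dF; exact: is_cvg_cst.
- split; first by move=> x _; exact: derivableM.
  by apply: cvg_at_right_filter; apply: cvgM; [exact: cvg_cst|exact: cvg_id].
- by apply: gt0_cvgMry => //; exact: cvg_id.
- apply/continuous_within_itvcyP; split.
    by move=> x; rewrite in_itv/= andbT => xa; apply: cf; apply: lt_trans xa; exact: mulr_gt0.
  by apply: cvg_at_right_filter; apply: cf; exact: mulr_gt0.
- move=> x; rewrite in_itv/= andbT => xa; apply: f0; apply: lt_trans xa; exact: mulr_gt0.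
Qed.

Lemma continuous_powR_gt0 (r x : R) : 0 < x -> {for x, continuous (@powR R ^~ r)}.
Proof.
move=> x0; apply: differentiable_continuous; apply/derivable1_diffP.
by have [] := is_derive1_powR r x0.
Qed.


Definition gamma_integrand (a b x : R) : R := x `^ (a - 1) * expR (- (b * x)).

Lemma gamma_integrand_ge0 a b x : 0 <= gamma_integrand a b x.
Proof. by rewrite mulr_ge0 ?powR_ge0 ?expR_ge0. Qed.

Lemma measurable_gamma_integrand a b : measurable_fun setT (gamma_integrand a b).
Proof.
apply: measurable_funM; first exact: measurable_powR.
by apply: measurableT_comp => //; apply: measurableT_comp.
Qed.

Lemma gamma_integral_scale (a b : R) : 0 < b ->
  (\int[mu]_(x in `]0%R, +oo[) (gamma_integrand a b x)%:E =
   (b `^ (- a))%:E * \int[mu]_(x in `]0%R, +oo[) (gamma_integrand a 1 x)%:E)%E.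
Proof.
move=> b0.
have cg x : 0 < x -> {for x, continuous (gamma_integrand a 1)}.
  move=> x0; apply: (@cvgM _ _ (nbhs x) _ (fun y => y `^ (a - 1))
    (fun y => expR (- (1 * y))) (x `^ (a - 1)) (expR (- (1 * x)))).
    exact: continuous_powR_gt0.
  apply: continuous_cvg; first exact: continuous_expR.
  by apply: cvgN; apply: cvgM; [exact: cvg_cst|exact: cvg_id].
rewrite (integral_oy_scale b0 cg (fun x _ => gamma_integrand_ge0 a 1 x)
  (measurable_gamma_integrand a 1)).
rewrite -ge0_integralZl_EFin ?powR_ge0//; last 2 first.
- by move=> x _; rewrite lee_fin mulr_ge0 ?gamma_integrand_ge0// ltW.
- apply/measurable_EFinP; apply: measurable_funTS; apply: measurable_funM => //.
  apply: measurableT_comp; first exact: measurable_gamma_integrand.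
  exact: measurable_funM.
apply: eq_integral => x /[!inE]/=; rewrite in_itv/= andbT => x0.
rewrite -EFinM; congr EFin; rewrite /gamma_integrand powRM ?ltW// mul1r.
have bb : b `^ (- a) * b `^ (a - 1) * b = 1.
  rewrite -[X in _ * X]powRr1 ?ltW// -!powRD ?(gt_eqF b0) ?implybT//.
  by rewrite (_ : _ + 1 = 0) ?powRr0//; lra.
transitivity ((b `^ (- a) * b `^ (a - 1) * b) * (x `^ (a - 1) * expR (- (b * x)))).
  by rewrite bb mul1r.
by rewrite -!mulrA; do 2 congr (_ * _); rewrite mulrC -mulrA.
Qed.

(** After rescaling to [b = 1], [exp(- x) <= 1 / (1 + x)] bounds the integrand by the
    derivative of [2 atan(sqrt x)], a bounded function. *)
Lemma gamma_integral_half_fin (b : R) : 0 < b ->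
  (\int[mu]_(x in `]0%R, +oo[) (gamma_integrand 2^-1 b x)%:E < +oo)%E.
Proof.
move=> b0; rewrite gamma_integral_scale// lte_mul_pinfty ?lee_fin ?powR_ge0//.
have half : 2^-1 - 1 = - 2^-1 :> R by lra.
apply: (@le_lt_trans _ _ (2 * pi)%:E); last exact: ltry.
have L := cvg_integral_oy ltr01 (measurable_gamma_integrand 2^-1 1)
  (fun x _ => gamma_integrand_ge0 _ _ _).
rewrite -(cvg_lim _ L)//; apply: lime_le; first by apply/cvg_ex; eexists; exact: L.
apply: nearW => n; set a := 1 / n.+1%:R.
have a0 : 0 < a by rewrite divr_gt0.
(* A real power instead of an inverse makes [f] measurable on the whole line. *)
pose f x : R := x `^ (- 2^-1) * (1 + x) `^ (-1).
pose F x : R := 2 * atan (x `^ 2^-1).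
have mf : measurable_fun setT f.
  apply: measurable_funM; first exact: measurable_powR.
  by apply: (measurableT_comp (measurable_powR _)); exact: measurable_funD.
apply: (@le_trans _ _ (\int[mu]_(x in `[a, +oo[) (f x)%:E)%E).
  apply: ge0_le_integral => //.
  - by move=> x _; rewrite lee_fin gamma_integrand_ge0.
  - by apply/measurable_EFinP; apply: measurable_funTS; exact: measurable_gamma_integrand.
  - by apply/measurable_EFinP; apply: measurable_funTS.
  - move=> x; rewrite /= in_itv/= andbT => ax; have x0 := lt_le_trans a0 ax.
    rewrite lee_fin /gamma_integrand half ler_wpM2l ?powR_ge0// mul1r expRN.
    have x1 : 0 < 1 + x by rewrite addr_gt0.
    by rewrite powR_inv1 ?(ltW x1)// lef_pV2 ?posrE ?expR_gt0// expR_ge1Dx.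
have dF (x : R) : 0 < x -> is_derive x (1 : R) F (f x).
  move=> x0.
  have dp := is_derive1_powR 2^-1 x0; have da := is_derive1_atan (x `^ 2^-1).
  have dc := @is_derive1_comp R atan (@powR R ^~ 2^-1) x _ _ da dp.
  have -> : f x = 2 * ((1 + (x `^ 2^-1) ^+ 2)^-1 * (2^-1 * x `^ (2^-1 - 1))).
    rewrite half -powR_mulrn ?powR_ge0// -powRrM mulVf// powRr1 ?ltW// /f.
    by rewrite mulrCA (mulrA 2) mulfV// mul1r mulrC powR_inv1// addr_ge0// ltW.
  exact: is_deriveZ.
have cF (x : R) : 0 < x -> {for x, continuous F}.
  move=> x0; apply: differentiable_continuous; apply/derivable1_diffP.
  by have [] := dF x x0.
have cf (x : R) : 0 < x -> {for x, continuous f}.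
  move=> x0; apply: (@cvgM _ _ (nbhs x) _ (fun y => y `^ (- 2^-1)) (fun y => (1 + y) `^ (-1))
    (x `^ (- 2^-1)) ((1 + x) `^ (-1))).
    exact: continuous_powR_gt0.
  apply: (@continuous_cvg _ _ _ (nbhs x) _ (fun y => 1 + y) (@powR R ^~ (-1))).
    by apply: continuous_powR_gt0; rewrite addr_gt0.
  by apply: cvgD; [exact: cvg_cst|exact: cvg_id].
have gt_a (x : R) : a < x -> 0 < x by exact: lt_trans.
rewrite (@ge0_continuous_FTC2y _ f F a pi).
- by rewrite -EFinB lee_fin /F; have := atan_gtNpi2 (a `^ 2^-1); lra.
- move=> x ax; have x0 := lt_le_trans a0 ax.
  by rewrite mulr_ge0 ?powR_ge0.
- apply/continuous_within_itvcyP; split.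
    by move=> x; rewrite in_itv/= andbT => xa; exact/cf/gt_a.
  by apply: cvg_at_right_filter; exact: cf.
- have -> : pi = 2 * (pi / 2) :> R by rewrite mulrCA mulfV ?mulr1.
  apply: cvgM; first exact: cvg_cst.
  apply: cvg_comp; last exact: cvgy_atan.
  apply/cvgryPge => A; near=> x.
  apply: (@le_trans _ _ ((A ^+ 2) `^ 2^-1)).
    by rewrite powR12_sqrt ?sqr_ge0// sqrtr_sqr ler_norm.
  have Ax : A ^+ 2 <= x by near: x; apply: nbhs_pinfty_ge; exact: num_real.
  by apply: ge0_ler_powR; rewrite // nnegrE ?(le_trans _ Ax) ?sqr_ge0.
- by move=> x /gt_a x0; have [] := dF x x0.
- by apply: cvg_at_right_filter; exact: cF.
- move=> x; rewrite in_itv/= andbT => /gt_a x0.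
  by rewrite derive1E; have [_ ->] := dF x x0.
Unshelve. all: by end_near. Qed.

(** Raising the exponent by one costs [x <= (2 / b) exp(b x / 2)], that is half of
    the exponential decay; hence the induction for all [b] at once. *)
Lemma gamma_integral_fin (n : nat) (b : R) : 0 < b ->
  (\int[mu]_(x in `]0%R, +oo[) (gamma_integrand (n.+1%:R - 2^-1) b x)%:E < +oo)%E.
Proof.
elim: n b => [|n IH] b b0.
  have -> : 1%:R - 2^-1 = 2^-1 :> R by lra.
  exact: gamma_integral_half_fin.
have b2 : 0 < b / 2 by rewrite divr_gt0.
apply: (@le_lt_trans _ _ (\int[mu]_(x in `]0%R, +oo[)
    ((b / 2)^-1%:E * (gamma_integrand (n.+1%:R - 2^-1) (b / 2) x)%:E)))%E.
  apply: ge0_le_integral => //.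
  - by move=> x _; rewrite lee_fin gamma_integrand_ge0.
  - by apply/measurable_EFinP; apply: measurable_funTS; exact: measurable_gamma_integrand.
  - apply/measurable_EFinP; apply: measurable_funTS.
    by apply: measurable_funM => //; exact: measurable_gamma_integrand.
  - move=> x; rewrite /= in_itv/= andbT => x0; rewrite -EFinM lee_fin /gamma_integrand.
    have -> : n.+2%:R - 2^-1 - 1 = (n.+1%:R - 2^-1 - 1) + 1 :> R by rewrite -natr1; lra.
    rewrite (@powRD _ x _ 1) ?(gt_eqF x0) ?implybT// powRr1 ?(ltW x0)//.
    rewrite -mulrA [X in _ <= X]mulrCA ler_wpM2l ?powR_ge0//.
    have -> : - (b * x) = - (b / 2 * x) + - (b / 2 * x) by lra.
    rewrite expRD mulrA ler_wpM2r ?expR_ge0// -ler_pdivlMr ?expR_gt0// expRN invrK.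
    rewrite ler_pdivlMl//; apply: le_trans (expR_ge1Dx _); lra.
rewrite ge0_integralZl_EFin//.
- by rewrite lte_mul_pinfty ?lee_fin ?invr_ge0 ?ltW//; exact: IH.
- by move=> x _; rewrite lee_fin gamma_integrand_ge0.
- by apply/measurable_EFinP; apply: measurable_funTS; exact: measurable_gamma_integrand.
- by rewrite invr_ge0 ltW.
Qed.

End gamma_integrals.

(** * Law and Levy density of the inverse Gaussian subordinator *)

Section inverse_gaussian.
Context d (T : measurableType d) (R : realType) (P : probability T R).
Variables (delta gamma : R) (Y : R -> T -> R).
Hypotheses (delta_gt0 : 0 < delta) (gamma_gt0 : 0 < gamma).
Hypothesis igsY : inverse_gaussian_subordinator P delta gamma Y.
Local Notation mu := (@lebesgue_measure R).

(** With the exponent [- 1/2] in [gamma_integrand], this is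
    [delta / sqrt(2 pi) x^(-3/2) exp(- gamma^2 x / 2)] on the positive half-line. *)
Definition igs_levy_density (x : R) : R :=
  \1_`]0, +oo[ x * (delta / Num.sqrt (2 * pi) * gamma_integrand (- 2^-1) (gamma ^+ 2 / 2) x).

(** The only factor of the density at time [h] that depends on both [x] and [h]. *)
Definition igs_damping (h x : R) : R := expR (- ((delta * h) ^+ 2 / 2 * x `^ (-1))).

Lemma igs_levy_density_ge0 x : 0 <= igs_levy_density x.
Proof.
apply: mulr_ge0; first by rewrite indicE.
by apply: mulr_ge0; rewrite ?gamma_integrand_ge0// divr_ge0// ltW.
Qed.

Lemma measurable_igs_levy_density : measurable_fun setT igs_levy_density.
Proof.
apply: measurable_funM => //; apply: measurable_funM => //.
exact: measurable_gamma_integrand.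
Qed.

Lemma igs_damping_ge0 h x : 0 <= igs_damping h x.
Proof. exact: expR_ge0. Qed.

Lemma measurable_igs_damping h : measurable_fun setT (igs_damping h).
Proof.
apply: measurableT_comp => //; apply: measurableT_comp => //.
by apply: measurable_funM => //; exact: measurable_powR.
Qed.

Lemma damped_density_ge0 h x : 0 <= igs_levy_density x * igs_damping h x.
Proof. by apply: mulr_ge0; [exact: igs_levy_density_ge0|exact: igs_damping_ge0]. Qed.

Lemma measurable_damped_density h :
  measurable_fun setT (fun x => igs_levy_density x * igs_damping h x).
Proof.
apply: measurable_funM; first exact: measurable_igs_levy_density.
exact: measurable_igs_damping.
Qed.

Lemma igs_densityE (h x : R) : 0 < h -> 0 < x ->
  igs_density delta gamma x h =
  (h * expR (delta * gamma * h)) * (igs_levy_density x * igs_damping h x).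
Proof.
move=> h0 x0; rewrite /igs_density /igs_levy_density /igs_damping /gamma_integrand.
rewrite indicE mem_set/= ?in_itv/= ?x0// mul1r.
have -> : (2 * pi) `^ (- 2^-1) = (Num.sqrt (2 * pi))^-1 :> R.
  by rewrite powRN powR12_sqrt// mulr_ge0// pi_ge0.
have -> : - (3 / 2) = - 2^-1 - 1 :> R by lra.
rewrite powR_inv1 ?ltW//.
have -> : delta * gamma * h - (delta ^+ 2 * h ^+ 2 * x^-1 + gamma ^+ 2 * x) / 2 =
    delta * gamma * h + - (gamma ^+ 2 / 2 * x) + - ((delta * h) ^+ 2 / 2 * x^-1).
  by rewrite exprMn; lra.
rewrite !expRD; ring.
Qed.

Lemma igs_law (h : R) (f : R -> R) : 0 < h ->
  measurable_fun setT f -> (forall x, 0 <= f x) ->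
  (\int[P]_w (f (Y h w))%:E = (h * expR (delta * gamma * h))%:E *
     \int[mu]_x (igs_levy_density x * igs_damping h x * f x)%:E)%E.
Proof.
move=> h0 mf f0; have [[[mY _ _ _ _] _ _] lawY] := igsY.
set c := h * expR _.
have c0 : 0 <= c by rewrite mulr_ge0 ?expR_ge0// ltW.
pose W x := c * (igs_levy_density x * igs_damping h x).
have W0 x : 0 <= W x.
  by apply: mulr_ge0 => //; exact: damped_density_ge0.
have mW : measurable_fun setT W.
  by apply: measurable_funM => //; exact: measurable_damped_density.
transitivity (\int[mu]_x (W x * f (id x))%:E)%E.
  under eq_integral do rewrite -[f _]mul1r.
  apply: (@integral_transfer _ _ _ _ _ _ _ P mu (fun=> 1) (Y h)) => //.
    by apply: mY; exact: ltW.
  move=> B mB; under eq_integral do rewrite mul1r.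
  rewrite integral_indic_comp//; last by apply: mY; exact: ltW.
  etransitivity; first exact: (lawY h B h0 mB).
  rewrite [LHS]integral_mkcond; apply: eq_integral => x _.
  rewrite patchE indicE in_setI.
  case: (boolP (x \in B)) => _ /=; last by rewrite mulr0.
  rewrite mulr1 /W; case: ifPn => [/set_mem/= x0|nx]; first by rewrite igs_densityE.
  rewrite /igs_levy_density indicE memNset ?mul0r ?mulr0//= in_itv/= andbT => x0.
  by move/negP: nx; apply; exact/mem_set.
rewrite -ge0_integralZl_EFin//.
- by apply: eq_integral => x _; rewrite -EFinM mulrA.
- by move=> x _; rewrite lee_fin; apply: mulr_ge0 => //; exact: damped_density_ge0.
- apply/measurable_EFinP; apply: measurable_funM => //.
  exact: measurable_damped_density.
Qed.

(** The times [t / n.+1] decrease, so the damping factors increase to 1 and monotone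
    convergence applies, whether or not the limit is finite. *)
Lemma igs_small_time (t : R) (f : R -> R) : 0 < t ->
  measurable_fun setT f -> (forall x, 0 <= f x) ->
  (((t / n.+1%:R * expR (delta * gamma * (t / n.+1%:R)))^-1%:E *
    \int[P]_w (f (Y (t / n.+1%:R)%R w))%:E)%E @[n --> \oo] -->
  (\int[mu]_x (igs_levy_density x * f x)%:E)%E).
Proof.
move=> t0 mf f0; pose h n : R := t / n.+1%:R.
have h0 n : 0 < h n by rewrite divr_gt0.
(* The prefactor of the density cancels exactly. *)
have -> : (fun n => ((h n * expR (delta * gamma * h n))^-1%:E *
    \int[P]_w (f (Y (h n) w))%:E)%E) =
  (fun n => \int[mu]_x (igs_levy_density x * igs_damping (h n) x * f x)%:E)%E.
  apply/funext => n; rewrite igs_law// muleA -EFinM mulVf ?mul1e//.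
  by rewrite mulf_neq0// gt_eqF// expR_gt0.
have powx (x : R) : 0 <= x `^ (-1) by exact: powR_ge0.
rewrite (_ : (\int[mu]_x _)%E = (\int[mu]_x
    (limn (fun n => (igs_levy_density x * igs_damping (h n) x * f x)%:E)))%E); last first.
  apply: eq_integral => x _; apply/esym/cvg_lim => //.
  apply: cvg_EFin; first exact: nearW.
  apply: cvgM; last exact: cvg_cst.
  rewrite -[X in _ --> X]mulr1; apply: cvgM; first exact: cvg_cst.
  rewrite -(expR0 R); apply: continuous_cvg; first exact: continuous_expR.
  rewrite -oppr0; apply: cvgN; rewrite -(mul0r (x `^ (-1))).
  apply: cvgM; last exact: cvg_cst.
  rewrite -(mul0r 2^-1); apply: cvgM; last exact: cvg_cst.
  rewrite (_ : 0 = (delta * (t * 0)) ^+ 2); last by rewrite !mulr0 expr0n.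
  have ch : delta * h n @[n --> \oo] --> delta * (t * 0).
    apply: cvgM; first exact: cvg_cst.
    by apply: cvgM; [exact: cvg_cst|exact: cvg_harmonic].
  by rewrite expr2; under eq_fun do rewrite expr2; exact: cvgM.
apply: cvg_monotone_convergence => //.
- move=> n; apply/measurable_EFinP; apply: measurable_funM => //.
  exact: measurable_damped_density.
- by move=> n x _; rewrite lee_fin; apply: mulr_ge0 => //; exact: damped_density_ge0.
- move=> x _ m n mn; rewrite lee_fin ler_wpM2r// ler_wpM2l ?igs_levy_density_ge0//.
  rewrite ler_expR lerN2; apply: ler_wpM2r => //; apply: ler_wpM2r => //.
  have dh0 i : 0 <= delta * h i by apply: mulr_ge0; exact: ltW.
  rewrite ler_sqr ?nnegrE ?dh0//.
  rewrite ler_pM2l// /h ler_pM2l// lef_pV2 ?posrE// ler_nat ltnS//.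
Qed.

Lemma igs_gamma_integral (n : nat) (b : R) : 0 < b ->
  (\int[mu]_x (igs_levy_density x * (x ^+ n.+1 * expR (- (b * x))))%:E =
   (delta / Num.sqrt (2 * pi) * (euler_gamma (n.+1%:R - 2^-1) /
     (b + gamma ^+ 2 / 2) `^ (n.+1%:R - 2^-1)))%:E)%E.
Proof.
move=> b0; set c := delta / _; set a : R := n.+1%:R - 2^-1; set b' := b + _.
have c0 : 0 <= c by rewrite divr_ge0// ltW.
have b'0 : 0 < b' by rewrite addr_gt0// divr_gt0// exprn_gt0.
transitivity (\int[mu]_(x in `]0%R, +oo[) (c%:E * (gamma_integrand a b' x)%:E))%E.
  rewrite [RHS]integral_mkcond; apply: eq_integral => x _.
  rewrite patchE /igs_levy_density indicE; case: ifPn => [/set_mem/=|_]; last by rewrite !mul0r.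
  rewrite in_itv/= andbT => x0; rewrite mul1r -EFinM -/c; congr EFin.
  rewrite /gamma_integrand -[LHS]mulrA; congr (c * _).
  rewrite mulrACA -powR_mulrn ?(ltW x0)// -powRD ?(gt_eqF x0) ?implybT// -expRD.
  by congr (_ `^ _ * expR _); rewrite /a /b'; lra.
rewrite ge0_integralZl_EFin//; last 2 first.
- by move=> x _; rewrite lee_fin gamma_integrand_ge0.
- by apply/measurable_EFinP; apply: measurable_funTS; exact: measurable_gamma_integrand.
clearbody c; rewrite gamma_integral_scale// EFinM; congr (_ * _)%E.
have := gamma_integral_fin n (@ltr01 R).
have -> : (\int[mu]_(x in `]0%R, +oo[) (gamma_integrand a 1 x)%:E)%E =
    (\int[mu]_(x in `]0%R, +oo[) (x `^ (a - 1) * expR (- x))%:E)%E.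
  by apply: eq_integral => x _; rewrite /gamma_integrand mul1r.
rewrite -/a => fin_gamma.
rewrite powRN mulrC EFinM; congr (_ * _)%E.
rewrite /euler_gamma /Rintegral fineK// ge0_fin_numE; last first.
  by apply: integral_ge0 => x _; rewrite lee_fin mulr_ge0 ?powR_ge0 ?expR_ge0.
exact: fin_gamma.
Qed.

(** The factor [1 - exp(- b x) <= b x] lowers the singularity of the density at 0
    from [x^(-3/2)] to the integrable [x^(-1/2)]. *)
Lemma igs_levy_density_mass (b : R) : 0 <= b ->
  (\int[mu]_x (igs_levy_density x * (1 - expR (- (b * `|x|))))%:E < +oo)%E.
Proof.
move=> b0.
set c := delta / Num.sqrt (2 * pi).
have c0 : 0 <= c by rewrite divr_ge0// ltW.
have g0 : 0 < gamma ^+ 2 / 2 by rewrite divr_gt0// exprn_gt0.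
have cb0 : 0 <= c * b by exact: mulr_ge0.
apply: (@le_lt_trans _ _ ((c * b)%:E *
    \int[mu]_(x in `]0%R, +oo[) (gamma_integrand 2^-1 (gamma ^+ 2 / 2) x)%:E)%E); last first.
  by rewrite lte_mul_pinfty ?lee_fin//; exact: gamma_integral_half_fin.
rewrite -ge0_integralZl_EFin//; last 2 first.
- by move=> x _; rewrite lee_fin gamma_integrand_ge0.
- by apply/measurable_EFinP; apply: measurable_funTS; exact: measurable_gamma_integrand.
rewrite [leRHS]integral_mkcond; apply: ge0_le_integral => //.
- move=> x _; rewrite lee_fin mulr_ge0 ?igs_levy_density_ge0// subr_ge0.
  by rewrite -expR0 ler_expR oppr_le0 mulr_ge0.
- apply/measurable_EFinP; apply: measurable_funM; first exact: measurable_igs_levy_density.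
  apply: measurable_funB => //; apply: measurableT_comp => //.
  by apply: measurableT_comp => //; apply: measurable_funM => //; exact: measurableT_comp.
- apply: (measurable_restrictT _ _).1 => //; apply: measurable_funTS.
  by apply: emeasurable_funM => //; apply/measurable_EFinP; exact: measurable_gamma_integrand.
- move=> x _; rewrite patchE /igs_levy_density indicE.
  case: ifPn => [/set_mem/=|_]; last by rewrite !mul0r.
  rewrite in_itv/= andbT => x0; rewrite mul1r -EFinM lee_fin -/c.
  rewrite -[leLHS]mulrA -[leRHS]mulrA; apply: ler_wpM2l => //; rewrite /gamma_integrand.
  have -> : 2^-1 - 1 = (- 2^-1 - 1) + 1 :> R by lra.
  rewrite (@powRD _ x _ 1) ?(gt_eqF x0) ?implybT// powRr1 ?(ltW x0)//.
  set p := x `^ _; set e := expR _.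
  rewrite [leRHS](_ : _ = p * (e * (b * x))); last by ring.
  rewrite -[leLHS]mulrA ler_wpM2l ?powR_ge0// ler_wpM2l ?expR_ge0// gtr0_norm//.
  by rewrite lerBlDr -lerBlDl; exact: expR_ge1Dx.
Qed.

End inverse_gaussian.

(** * Atomic measures and the Levy weights *)

Section atomic_measure.
Local Open Scope ereal_scope.
Context {R : realType}.

Definition atomic_measure (c : nat -> {nonneg R}) : {measure set R -> \bar R} :=
  mseries (fun n => mscale (c n) (dirac (n%:R : R))) 0.

Lemma atomic_measureE (c : nat -> {nonneg R}) (A : set R) :
  atomic_measure c A = \sum_(n <oo) ((c n)%:num%:E * \d_(n%:R : R) A).
Proof. by []. Qed.

Lemma integral_atomic (c : nat -> {nonneg R}) (G : R -> R) :
  measurable_fun setT G -> (forall x, 0 <= G x)%R ->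
  \int[atomic_measure c]_x (G x)%:E = \sum_(n <oo) ((c n)%:num * G n%:R)%:E.
Proof.
move=> mG G0.
have mEG : measurable_fun setT (fun x => (G x)%:E) by exact/measurable_EFinP.
rewrite ge0_integral_measure_series//; last by move=> x _; rewrite lee_fin.
apply: eq_eseriesr => n _.
rewrite ge0_integral_mscale//; last by move=> x _; rewrite lee_fin.
by rewrite integral_dirac// diracT mul1e EFinM.
Qed.

Lemma integral_nat_valued d (T : measurableType d) (P : probability T R)
    (X : T -> nat) (g : nat -> R) :
  measurable_fun setT X -> (forall n, 0 <= g n)%R ->
  \int[P]_w (g (X w))%:E = \sum_(n <oo) ((g n)%:E * P (X @^-1` [set n])).
Proof.
move=> mX g0.
have UX : \bigcup_n (X @^-1` [set n]) = setT.
  by apply/seteqP; split => w // _; exists (X w).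
have mXn n : measurable (X @^-1` [set n]) by exact: measurable_fun_fiber.
have mg : measurable_fun setT (fun w => (g (X w))%:E).
  by apply/measurable_EFinP; apply: measurableT_comp mX.
rewrite -[in LHS]UX ge0_integral_bigcup//=; last 3 first.
- by rewrite UX.
- by move=> w _; rewrite lee_fin.
- apply/trivIsetP => i j _ _; apply: contra_neqP => /eqP/set0P[w [/= <- <-]].
  by [].
apply: eq_eseriesr => n _.
rewrite (eq_integral (fun=> (g n)%:E)); last by move=> w /[!inE] /= ->.
by rewrite integral_cst.
Qed.

End atomic_measure.

Section levy_coefficients.
Context d (T : measurableType d) (R : realType) (P : probability T R).
Variables (k : nat) (lambda : 'I_k -> R) (M : R -> T -> nat).
Variables (delta gamma : R).
Hypotheses (delta_gt0 : 0 < delta) (gamma_gt0 : 0 < gamma).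
Hypothesis lambda_gt0 : forall j, 0 < lambda j.
Hypothesis gcpM : generalized_counting_process P lambda M.
Hypothesis k_gt0 : (0 < k)%N.
Local Notation mu := (@lebesgue_measure R).
Local Notation rho := (igs_levy_density delta gamma).
Let Lambda := \sum_(j < k) lambda j.

Let mM t : 0 <= t -> measurable_fun setT (M t).
Proof. exact: (gcp_measurable gcpM). Qed.

Let mphi A : measurable_fun setT (gcp_marginal P M A).
Proof. exact: (measurable_gcp_marginal lambda_gt0 gcpM). Qed.

Let rho_ge0 x : 0 <= rho x. Proof. exact: igs_levy_density_ge0. Qed.

Let mrho : measurable_fun setT rho. Proof. exact: measurable_igs_levy_density. Qed.

Lemma rho_le0 x : x <= 0 -> rho x = 0.
Proof. by move=> x0; rewrite /igs_levy_density indicE memNset ?mul0r//= in_itv/= andbT ltNge x0. Qed.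

Lemma euler_gamma_ge0 (s : R) : 0 <= euler_gamma s.
Proof. by apply: Rintegral_ge0 => x _; rewrite mulr_ge0 ?powR_ge0 ?expR_ge0. Qed.

Definition levy_coefficient (n : nat) : R :=
  \sum_(x in Omega k n)
    (\prod_(j < k) (lambda j ^+ x j / (x j)`!%:R)) *
    (let s := (\sum_(j < k) x j)%N in
     euler_gamma (s%:R - 2^-1) / (Lambda + gamma ^+ 2 / 2) `^ (s%:R - 2^-1)).

(** At [n = 0] the integral of [P(M(x) = 0)] against the Levy density of [Y]
    diverges, and a Levy measure does not charge 0. *)
Definition levy_weight (n : nat) : R :=
  if n is 0%N then 0 else delta / Num.sqrt (2 * pi) * levy_coefficient n.

Lemma levy_coefficient_ge0 n : 0 <= levy_coefficient n.
Proof.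
apply: sumr_ge0 => x _; apply: mulr_ge0.
  by apply: prodr_ge0 => j _; rewrite divr_ge0// exprn_ge0// ltW.
by rewrite divr_ge0 ?powR_ge0// euler_gamma_ge0.
Qed.

Lemma levy_weight_ge0 n : 0 <= levy_weight n.
Proof.
case: n => [//|n]; apply: mulr_ge0; last exact: levy_coefficient_ge0.
by rewrite divr_ge0// ltW.
Qed.

Lemma gcp_marginal_pmf (n : nat) (h : R) : 0 < h ->
  gcp_marginal P M [set n] h =
  \sum_(x in Omega k n) (\prod_(j < k) (lambda j ^+ x j / (x j)`!%:R)) *
    (h ^+ (\sum_(j < k) x j)%N * expR (- (Lambda * h))).
Proof.
move=> h0; rewrite /gcp_marginal gtr0_norm// (gcp_pmf gcpM)//=.
apply: eq_bigr => x _.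
rewrite /Lambda mulr_suml -sumrN expR_sum -prodrXr -!big_split/=.
apply: eq_bigr => j _; rewrite /poisson_pmf mulr_gt0// exprMn; ring.
Qed.

(** For [n > 0] every solution in [Omega k n] has [s > 0], so each term is a
    convergent Gamma integral. *)
Lemma levy_weightE (n : nat) : (0 < n)%N ->
  (\int[mu]_x (rho x * gcp_marginal P M [set n] x)%:E = (levy_weight n)%:E)%E.
Proof.
case: n => // n _; rewrite /levy_weight /levy_coefficient.
have L0 : 0 < Lambda.
  rewrite /Lambda (bigD1 (Ordinal k_gt0))//= ltr_pwDl// sumr_ge0// => j _.
  exact: ltW.
set c := delta / _.
pose w (x : {ffun 'I_k -> 'I_n.+2}) := \prod_(j < k) (lambda j ^+ x j / (x j)`!%:R).
have w0 x : 0 <= w x.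
  by apply: prodr_ge0 => j _; rewrite divr_ge0// exprn_ge0// ltW.
pose s (x : {ffun 'I_k -> 'I_n.+2}) := (\sum_(j < k) x j)%N.
have s_gt0 y : y \in Omega k n.+1 -> (0 < s y)%N.
  rewrite inE lt0n => /eqP sy; apply/eqP => s0.
  suff : (\sum_(j < k) j.+1 * y j = 0)%N by rewrite sy.
  move: s0 => /eqP; rewrite sum_nat_eq0 => /forallP s0.
  by apply: big1 => j _; rewrite (eqP (implyP (s0 j) isT)) muln0.
transitivity (\int[mu]_x (\sum_(y <- enum (Omega k n.+1))
    ((w y)%:E * (rho x * (x ^+ (s y).-1.+1 * expR (- (Lambda * x))))%:E)))%E.
  apply: eq_integral => x _; rewrite big_enum/= sumEFin; congr EFin.
  have [x0|x0] := ltP 0 x; last first.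
    by rewrite rho_le0// mul0r big1// => y _; rewrite mul0r mulr0.
  rewrite gcp_marginal_pmf// mulr_sumr; apply: eq_bigr => y /s_gt0 sy.
  by rewrite prednK// mulrCA.
rewrite ge0_integral_sum//; last 2 first.
- move=> y; apply/measurable_EFinP; apply: measurable_funM => //; apply: measurable_funM => //.
  apply: measurable_funM => //; apply: measurableT_comp => //; apply: measurableT_comp => //.
- move=> y x _; have [x0|x0] := ltP 0 x; last first.
    by rewrite rho_le0// mul0r mule0.
  by rewrite -EFinM lee_fin; do ?apply: mulr_ge0 => //; rewrite ?exprn_ge0 ?expR_ge0// ltW.
rewrite big_enum/= mulr_sumr -sumEFin; apply: eq_bigr => y /s_gt0 sy.
rewrite ge0_integralZl_EFin//; last 2 first.
- move=> x _; have [x0|x0] := ltP 0 x; last first.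
    by rewrite rho_le0// mul0r.
  by rewrite lee_fin; do ?apply: mulr_ge0 => //; rewrite ?exprn_ge0 ?expR_ge0// ltW.
- apply/measurable_EFinP; apply: measurable_funM => //.
  apply: measurable_funM => //; apply: measurableT_comp => //; apply: measurableT_comp => //.
rewrite igs_gamma_integral// prednK// -EFinM; congr EFin.
by rewrite mulrCA.
Qed.

(** The measure with masses [levy_weight n] is the mixture of the laws of [M x]
    outside 0, with mixing measure the Levy measure of [Y]. *)
Lemma igs_mixture_integral (g : nat -> R) : (forall n, 0 <= g n) -> g 0%N = 0 ->
  (\sum_(n <oo) (levy_weight n * g n)%:E =
   \int[mu]_x ((rho x)%:E * \int[P]_w (g (M `|x| w))%:E))%E.
Proof.
move=> g0 gz.
transitivity (\sum_(n <oo) \int[mu]_x ((g n)%:E * (rho x * gcp_marginal P M [set n] x)%:E))%E.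
  apply: eq_eseriesr => -[|n] _; first by rewrite gz mulr0; under eq_integral do rewrite mul0e; rewrite integral0.
  rewrite ge0_integralZl_EFin//; last 2 first.
  - by move=> x _; rewrite lee_fin; apply: mulr_ge0 => //; exact: gcp_marginal_ge0.
  - by apply/measurable_EFinP; apply: measurable_funM; [exact: mrho|exact: mphi].
  by rewrite levy_weightE// mulrC EFinM.
rewrite -integral_nneseries//; last 2 first.
- move=> n; apply/measurable_EFinP; apply: measurable_funM => //.
  by apply: measurable_funM; [exact: mrho|exact: mphi].
- move=> n x _; rewrite -EFinM lee_fin; apply: mulr_ge0 => //; apply: mulr_ge0 => //.
  exact: gcp_marginal_ge0.
apply: eq_integral => x _.
rewrite integral_nat_valued//; last exact: mM.
rewrite -nneseriesZl; last by move=> n _; rewrite mule_ge0// lee_fin.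
apply: eq_eseriesr => n _; rewrite -[P _]fineK; last first.
  by rewrite fin_num_measure//; apply: measurable_fun_fiber; exact: mM.
by rewrite -!EFinM mulrCA.
Qed.

End levy_coefficients.

(** * Characteristic function of a Levy process from its small-time behaviour *)

Section bounded_expectation.
Context d (T : measurableType d) (R : realType).

Lemma integrable_bounded (m : {measure set T -> \bar R}) (f : T -> R) (b : R) :
  (m setT < +oo)%E -> measurable_fun setT f -> (forall x, `|f x| <= b) ->
  m.-integrable setT (EFin \o f).
Proof.
move=> mfin mf fb; apply: measurable_bounded_integrable => //.
exists b; split; first exact: num_real.
by move=> y by_ x _ /=; apply: le_trans (ltW by_).
Qed.

Variable P : probability T R.

Lemma integrable_bounded_prob (f : T -> R) (b : R) :
  measurable_fun setT f -> (forall x, `|f x| <= b) ->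
  P.-integrable setT (EFin \o f).
Proof. by apply: integrable_bounded; rewrite /= probability_setT ltry. Qed.

Lemma Rintegral_prob_cst (r : R) : \int[P]_w r = r.
Proof. by rewrite Rintegral_cst//= probability_setT mulr1. Qed.

(** Reduces to functions with values in [0, 1] by the affine map
    [x |-> (1 + x) / 2]. *)
Lemma Rintegral_prod_independent2 (A B : T -> R) (f g : R -> R) :
  measurable_fun setT A -> measurable_fun setT B ->
  (forall C D, measurable C -> measurable D ->
     P (A @^-1` C `&` B @^-1` D) = (P (A @^-1` C) * P (B @^-1` D))%E) ->
  measurable_fun setT f -> measurable_fun setT g ->
  (forall x, `|f x| <= 1) -> (forall x, `|g x| <= 1) ->
  \int[P]_w (f (A w) * g (B w)) = (\int[P]_w f (A w)) * (\int[P]_w g (B w)).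
Proof.
move=> mA mB indep mf mg f1 g1.
have mfA : measurable_fun setT (fun w => f (A w)) by exact: measurableT_comp.
have mgB : measurable_fun setT (fun w => g (B w)) by exact: measurableT_comp.
pose h (a : R -> R) x := 2^-1 * (1 + a x).
have h01 a x : `|a x| <= 1 -> 0 <= h a x <= 1.
  by rewrite ler_norml /h => /andP[? ?]; apply/andP; split; lra.
have mh a : measurable_fun setT a -> measurable_fun setT (h a).
  by move=> ma; apply: measurable_funM => //; exact: measurable_funD.
have := @integral_prod_independent _ _ _ _ _ P bool
  (fun b => if b then A else B) (fun b => if b then h f else h g).
rewrite big_bool/= => H.
have {}H : (\int[P]_w (h f (A w) * h g (B w))%:E =
    \int[P]_w (h f (A w))%:E * \int[P]_w (h g (B w))%:E)%E.
  rewrite -H.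
  - by apply: eq_integral => w _; rewrite big_bool.
  - by case.
  - move=> D mD; rewrite big_bool/= -indep; [|exact: mD|exact: mD].
    congr (P _); apply/seteqP; split => w /= Dw.
      by split; [exact: (Dw true)|exact: (Dw false)].
    by case => _; case: Dw.
  - by case; exact: mh.
  - by case=> x; apply: h01.
have hE (a : R -> R) (X : T -> R) : measurable_fun setT (fun w => a (X w)) -> (forall x, `|a x| <= 1) ->
    \int[P]_w h a (X w) = 2^-1 * (1 + \int[P]_w a (X w)).
  move=> maX a1; rewrite RintegralZl//; last first.
    apply: (@integrable_bounded_prob _ 2); first exact: measurable_funD.
    by move=> w; apply: le_trans (ler_normD _ _) _; rewrite normr1 lerD.
  rewrite RintegralD//; first by rewrite Rintegral_prob_cst.
  - by apply: (@integrable_bounded_prob _ 1) => // w; rewrite normr1.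
  - exact: (@integrable_bounded_prob _ 1).
have ifA := @integrable_bounded_prob _ 1 mfA (fun w => f1 (A w)).
have igB := @integrable_bounded_prob _ 1 mgB (fun w => g1 (B w)).
have ifg : P.-integrable setT (EFin \o (fun w => f (A w) * g (B w))).
  apply: (@integrable_bounded_prob _ 1); first exact: measurable_funM.
  by move=> w; rewrite normrM mulr_ile1.
have i1 : P.-integrable setT (EFin \o (fun _ : T => 1)).
  by apply: (@integrable_bounded_prob _ 1) => // w; rewrite normr1.
have fin (a : R -> R) (X : T -> R) : measurable_fun setT (fun w => a (X w)) -> (forall x, `|a x| <= 1) ->
    (\int[P]_w (h a (X w))%:E)%E \is a fin_num.
  move=> maX a1; apply: integrable_fin_num => //.
  apply: (@integrable_bounded_prob _ 1).
    by apply: measurable_funM => //; exact: measurable_funD.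
  by move=> w; have /andP[h0 h1] := h01 a (X w) (a1 _); rewrite ger0_norm.
have {H} : \int[P]_w (h f (A w) * h g (B w)) =
    (2^-1 * (1 + \int[P]_w f (A w))) * (2^-1 * (1 + \int[P]_w g (B w))).
  by rewrite -!hE// /Rintegral H fineM// fin.
have -> : \int[P]_w (h f (A w) * h g (B w)) =
    \int[P]_w (4^-1 * ((1 + f (A w)) + (g (B w) + f (A w) * g (B w)))).
  by apply: eq_Rintegral => w _; rewrite /h; field.
rewrite RintegralZl//; last first.
  apply: (@integrableD _ _ _ P setT _ (EFin \o (fun w => 1 + f (A w)))
    (EFin \o (fun w => g (B w) + f (A w) * g (B w)))) => //.
    exact: (@integrableD _ _ _ P setT _ (EFin \o (fun w => 1)) (EFin \o (fun w => f (A w)))).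
  exact: (@integrableD _ _ _ P setT _ (EFin \o (fun w => g (B w)))
    (EFin \o (fun w => f (A w) * g (B w)))).
rewrite RintegralD//; last 2 first.
- exact: (@integrableD _ _ _ P setT _ (EFin \o (fun w => 1)) (EFin \o (fun w => f (A w)))).
- exact: (@integrableD _ _ _ P setT _ (EFin \o (fun w => g (B w)))
    (EFin \o (fun w => f (A w) * g (B w)))).
rewrite RintegralD// RintegralD// Rintegral_prob_cst => H.
set a := \int[P]_w f (A w) in H *; set b := \int[P]_w g (B w) in H *.
set c := \int[P]_w _ in H *.
lra.
Qed.

End bounded_expectation.

Section complex_exponential.
Context {R : realType}.
Local Open Scope complex_scope.

Lemma normc_le (z : R[i]) : `|z| <= (`|complex.Re z| + `|complex.Im z|)%:C.
Proof.
rewrite normc_def lecR -[leRHS]ger0_norm ?addr_ge0// -sqrtr_sqr.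
apply: ler_wsqrtr; rewrite sqrrD !real_normK ?num_real//.
by rewrite -addrA lerD2l lerDr mulrn_wge0// mulr_ge0.
Qed.

Lemma cexpD (z w : R[i]) : cexp (z + w) = cexp z * cexp w.
Proof.
case: z => a b; case: w => a' b'; rewrite /cexp /=; simpc.
by rewrite expRD cosD sinD; congr (_ +i* _); ring.
Qed.

Lemma cexp0 : cexp (0 : R[i]) = 1.
Proof. by rewrite /cexp /= expR0 cos0 sin0 mulr1 mulr0. Qed.

Lemma cexp_mulrn (z : R[i]) n : cexp (z *+ n) = cexp z ^+ n.
Proof.
elim: n => [|n IH]; first by rewrite mulr0n cexp0.
by rewrite mulrS cexpD IH exprS.
Qed.

Lemma norm_cexp_le1 (z : R[i]) : complex.Re z <= 0 -> `|cexp z| <= 1.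
Proof.
move=> z0; rewrite normc_def /cexp /= !exprMn -mulrDr cos2Dsin2 mulr1 sqrtr_sqr.
by rewrite (ger0_norm (expR_ge0 _)) lecR -expR0 ler_expR.
Qed.

Lemma norm_expB_le (K : numDomainType) (a b : K) (n : nat) :
  `|a| <= 1 -> `|b| <= 1 -> `|a ^+ n - b ^+ n| <= `|a - b| *+ n.
Proof.
move=> a1 b1; elim: n => [|n IH]; first by rewrite !expr0 subrr normr0.
have -> : a ^+ n.+1 - b ^+ n.+1 = (a - b) * b ^+ n + a * (a ^+ n - b ^+ n).
  by rewrite !exprS; ring.
rewrite mulrS; apply: le_trans (ler_normD _ _) _; rewrite !normrM; apply: lerD.
  by rewrite normrX ler_piMr// exprn_ile1.
by apply: le_trans IH; rewrite ler_piMl.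
Qed.

(** The real and imaginary parts of the derivative at 0 of [h |-> cexp(h (p + iq))],
    along [h = 1 / n.+1]. *)
Lemma cvg_cexp_quotient (p q : R) :
  (n.+1%:R * (expR (p / n.+1%:R) * cos (q / n.+1%:R) - 1) @[n --> \oo] --> p) /\
  (n.+1%:R * (expR (p / n.+1%:R) * sin (q / n.+1%:R)) @[n --> \oo] --> q).
Proof.
have quot (f : R -> R) (df : R) : is_derive 0 (1 : R) f df ->
    n.+1%:R * (f n.+1%:R^-1 - f 0) @[n --> \oo] --> df.
  move=> [fd fdf].
  have c0 : n.+1%:R^-1 @[n --> \oo] --> (0 : R)^'.
    move=> S S0; have H := @cvg_harmonic R _ S0.
    apply: (@filterS _ \oo _ _ _ _ H) => n; apply.
    by rewrite /= /harmonic invr_neq0.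
  have := cvg_comp _ _ c0 fd; rewrite -/(derive f 0 1) fdf.
  apply: cvg_trans; apply: near_eq_cvg; apply: nearW => n /=.
  by rewrite invrK /GRing.scale /= mulr1 addr0.
have dl (c : R) : is_derive (0 : R) (1 : R) (fun x => c * x) c.
  by apply: is_derive_eq; rewrite /GRing.scale /= mulr1.
have de := is_derive1_comp (is_derive_expR _) (dl p).
have dc := is_derive1_comp (is_derive_cos _) (dl q).
have ds := is_derive1_comp (is_derive_sin _) (dl q).
split.
  have := quot (fun x => expR (p * x) * cos (q * x)) _ (is_deriveM de dc).
  rewrite /= !mulr0 expR0 cos0 sin0 /GRing.scale /= oppr0 mul0r mulr0 add0r !mul1r.
  exact.
have := quot (fun x => expR (p * x) * sin (q * x)) _ (is_deriveM de ds).
rewrite /= !mulr0 expR0 cos0 sin0 /GRing.scale /= mul0r addr0 !mul1r.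
by under eq_fun do rewrite subr0.
Qed.

End complex_exponential.

Section levy_charfun.
Context d (T : measurableType d) (R : realType) (P : probability T R).
Variables (X : R -> T -> R) (u : R).
Hypothesis levyX : levy_process P X.
Local Open Scope complex_scope.

Let mX t : 0 <= t -> measurable_fun setT (X t).
Proof. by have [mX _ _ _ _] := levyX; exact: mX. Qed.

Let fcos (x : R) := cos (u * x).
Let fsin (x : R) := sin (u * x).

Let mfcos : measurable_fun setT fcos.
Proof.
apply: measurableT_comp; first (by apply: continuous_measurable_fun; exact: continuous_cos).
exact: measurable_funM.
Qed.

Let mfsin : measurable_fun setT fsin.
Proof.
apply: measurableT_comp; first (by apply: continuous_measurable_fun; exact: continuous_sin).
exact: measurable_funM.
Qed.

Let fcos1 x : `|fcos x| <= 1. Proof. exact: cos_max. Qed.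

Let fsin1 x : `|fsin x| <= 1. Proof. exact: sin_max. Qed.

Lemma charfunE (V : T -> R) :
  charfun P V u = (\int[P]_w fcos (V w)) +i* (\int[P]_w fsin (V w)).
Proof.
by rewrite /charfun /cintegral; congr (_ +i* _); apply: eq_Rintegral => w _;
  rewrite /= expR0 mul1r.
Qed.

(** With [c] and [s] the two components, [c^2 + s^2] is the mean of
    [c cos + s sin], which is at most [(c^2 + s^2 + 1) / 2] pointwise. *)
Lemma charfun_norm_le1 (V : T -> R) : measurable_fun setT V ->
  `|charfun P V u| <= 1.
Proof.
move=> mV; rewrite charfunE normc_def lecR /=.
set c := \int[P]_w fcos (V w); set s := \int[P]_w fsin (V w).
have ic : P.-integrable setT (EFin \o (fun w => c * fcos (V w))).
  apply: (@integrable_bounded_prob _ _ _ P _ `|c|).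
    by apply: measurable_funM => //; exact: measurableT_comp.
  by move=> w; rewrite normrM ler_piMr.
have is_ : P.-integrable setT (EFin \o (fun w => s * fsin (V w))).
  apply: (@integrable_bounded_prob _ _ _ P _ `|s|).
    by apply: measurable_funM => //; exact: measurableT_comp.
  by move=> w; rewrite normrM ler_piMr.
have ics : c ^+ 2 + s ^+ 2 = \int[P]_w (c * fcos (V w) + s * fsin (V w)).
  rewrite RintegralD// !RintegralZl//.
    by apply: (@integrable_bounded_prob _ _ _ P _ 1) => //; exact: measurableT_comp.
  by apply: (@integrable_bounded_prob _ _ _ P _ 1) => //; exact: measurableT_comp.
have : c ^+ 2 + s ^+ 2 <= 2^-1 * (c ^+ 2 + s ^+ 2 + 1).
  rewrite [leLHS]ics -[leRHS](Rintegral_prob_cst P); apply: le_Rintegral => //.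
  - exact: (@integrableD _ _ _ P setT _ (EFin \o (fun w => c * fcos (V w)))
      (EFin \o (fun w => s * fsin (V w)))).
  - by apply: (@integrable_bounded_prob _ _ _ P _
      `|2^-1 * (c ^+ 2 + s ^+ 2 + 1)|).
  - move=> w _; have := cos2Dsin2 (u * V w); rewrite -/(fcos _) -/(fsin _).
    have := sqr_ge0 (c - fcos (V w)); have := sqr_ge0 (s - fsin (V w)).
    by rewrite !sqrrB; nra.
move=> h; rewrite -(sqrtr1 R); apply: ler_wsqrtr; lra.
Qed.

Let expect_increment (f : R -> R) (t : R) : 0 <= t ->
  measurable_fun setT f ->
  \int[P]_w f (X t w) = \int[P]_w f (X t w - X 0 w).
Proof.
move=> t0 mf; congr fine; have [_ X0 _ _ _] := levyX.
apply: ae_eq_integral => //.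
- by apply/measurable_EFinP; apply: measurableT_comp => //; exact: mX.
- apply/measurable_EFinP; apply: measurableT_comp => //.
  by apply: measurable_funB; exact: mX.
- by move: X0; apply: filterS => w X0w _; rewrite X0w subr0.
Qed.

Let expect_stationary (f : R -> R) (s h : R) : 0 <= s -> 0 <= h ->
  measurable_fun setT f -> (forall x, `|f x| <= 1) ->
  \int[P]_w f (X (s + h) w - X s w) = \int[P]_w f (X h w).
Proof.
move=> s0 h0 mf f1; rewrite (expect_increment h0)//.
have sh0 : 0 <= s + h by exact: addr_ge0.
have mI a b : 0 <= a -> 0 <= b -> measurable_fun setT (fun w => X b w - X a w).
  by move=> a0 b0; apply: measurable_funB; exact: mX.
have E : (\int[P]_w (1 * (1 + f (X (s + h) w - X s w)))%:E =
    \int[P]_w (1 * (1 + f (X h w - X 0 w)))%:E)%E.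
  apply: (@integral_transfer _ _ _ _ _ _ _ P P (fun=> 1)
    (fun w => X (s + h) w - X s w) (fun=> 1) (fun w => X h w - X 0 w) (fun x => 1 + f x)) => //.
  - exact: mI.
  - exact: mI.
  - move=> C mC; under eq_integral do rewrite mul1r.
    under [RHS]eq_integral do rewrite mul1r.
    rewrite !integral_indic_comp//; [|exact: mI|exact: mI].
    by have [_ _ _ stat _] := levyX; exact: stat.
  - exact: measurable_funD.
  - by move=> x; have := f1 x; rewrite ler_norml => /andP[]; lra.
have split1 V : measurable_fun setT V ->
    \int[P]_w (1 * (1 + f (V w))) = 1 + \int[P]_w f (V w).
  move=> mV; under eq_Rintegral do rewrite mul1r.
  rewrite RintegralD// ?Rintegral_prob_cst//.
  - by apply: (@integrable_bounded_prob _ _ _ P _ 1) => // w; rewrite normr1.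
  - by apply: (@integrable_bounded_prob _ _ _ P _ 1) => //; exact: measurableT_comp.
apply: (@addrI _ 1); rewrite -!split1//; [|exact: mI|exact: mI].
by rewrite /Rintegral E.
Qed.

Let expect_product (f g : R -> R) (s h : R) : 0 <= s -> 0 <= h ->
  measurable_fun setT f -> measurable_fun setT g ->
  (forall x, `|f x| <= 1) -> (forall x, `|g x| <= 1) ->
  \int[P]_w (f (X s w - X 0 w) * g (X (s + h) w - X s w)) =
  (\int[P]_w f (X s w)) * (\int[P]_w g (X h w)).
Proof.
move=> s0 h0 mf mg f1 g1.
have sh0 : 0 <= s + h by exact: addr_ge0.
rewrite (expect_increment s0)// -(expect_stationary s0 h0)//.
apply: (@Rintegral_prod_independent2 _ _ _ P (fun w => X s w - X 0 w)
  (fun w => X (s + h) w - X s w)) => //.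
- by apply: measurable_funB; exact: mX.
- by apply: measurable_funB; exact: mX.
move=> C D mC mD; have [_ _ indep _ _] := levyX.
pose t i : R := if i is i'.+1 then (if i' is 0%N then s else s + h) else 0.
have tnd i : t i <= t i.+1 by case: i => [|[|i]] //=; rewrite lerDl.
pose A (i : 'I_2) : set T := if val i is 0%N then (fun w => X s w - X 0 w) @^-1` C
  else (fun w => X (s + h) w - X s w) @^-1` D.
have := indep 2%N t (lexx 0) tnd [set: 'I_2]%SET A.
rewrite bigcap_finsetT; under [in RHS]eq_bigl do rewrite inE.
rewrite big_ord_recl big_ord1 /= => <-; last first.
  move=> i _; case: i => -[|[|//]] i2; [by exists C|by exists D].
congr (P _); apply/seteqP; split => w.
  by move=> [wC wD] i _; case: i => -[|[|//]] i2.
by move=> H; split; [exact: (H ord0 I)|exact: (H (lift ord0 ord0) I)].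
Qed.

Lemma levy_charfunD (s h : R) : 0 <= s -> 0 <= h ->
  charfun P (X (s + h)) u = charfun P (X s) u * charfun P (X h) u.
Proof.
move=> s0 h0; rewrite !charfunE; have sh0 : 0 <= s + h by exact: addr_ge0.
have mA : measurable_fun setT (fun w => X s w - X 0 w).
  by apply: measurable_funB; exact: mX.
have mB : measurable_fun setT (fun w => X (s + h) w - X s w).
  by apply: measurable_funB; exact: mX.
have ifg (f g : R -> R) : measurable_fun setT f -> measurable_fun setT g ->
    (forall x, `|f x| <= 1) -> (forall x, `|g x| <= 1) ->
    P.-integrable setT (EFin \o (fun w => f (X s w - X 0 w) * g (X (s + h) w - X s w))).
  move=> mf mg f1 g1; apply: (@integrable_bounded_prob _ _ _ P _ 1).
    by apply: measurable_funM; exact: measurableT_comp.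
  by move=> w; rewrite normrM mulr_ile1.
have -> : \int[P]_w fcos (X (s + h) w) =
    (\int[P]_w fcos (X s w)) * (\int[P]_w fcos (X h w)) -
    (\int[P]_w fsin (X s w)) * (\int[P]_w fsin (X h w)).
  rewrite -!expect_product// -RintegralB//; [|exact: ifg|exact: ifg].
  rewrite (expect_increment sh0)//; apply: eq_Rintegral => w _.
  by rewrite -cosD -mulrDr; congr (cos (u * _)); ring.
have -> : \int[P]_w fsin (X (s + h) w) =
    (\int[P]_w fsin (X s w)) * (\int[P]_w fcos (X h w)) +
    (\int[P]_w fcos (X s w)) * (\int[P]_w fsin (X h w)).
  rewrite -!expect_product// -RintegralD//; [|exact: ifg|exact: ifg].
  rewrite (expect_increment sh0)//; apply: eq_Rintegral => w _.
  by rewrite -sinD -mulrDr; congr (sin (u * _)); ring.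
by simpc; congr (_ +i* _); rewrite addrC.
Qed.

Lemma levy_charfun_mulrn (h : R) (n : nat) : 0 <= h ->
  charfun P (X (h *+ n.+1)) u = charfun P (X h) u ^+ n.+1.
Proof.
move=> h0; elim: n => [|n IH]; first by rewrite mulr1n expr1.
by rewrite mulrSr levy_charfunD ?mulrn_wge0// IH [RHS]exprSr.
Qed.

Lemma levy_charfun0 : charfun P (X 0) u = 1.
Proof.
rewrite charfunE !(expect_increment (lexx 0))//.
under eq_Rintegral do rewrite subrr.
under [X in _ +i* X]eq_Rintegral do rewrite subrr.
by rewrite !Rintegral_prob_cst /fcos /fsin mulr0 cos0 sin0.
Qed.

(** Both [charfun P (X t) u] and the exponential are powers of order [n.+1] of
    their values at time [t / n.+1], which agree up to [o(1 / n)]. *)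
Lemma levy_charfun_exponent (p q : R) : p <= 0 ->
  (forall t : R, 0 < t ->
     n.+1%:R * (\int[P]_w fcos (X (t / n.+1%:R) w) - 1) @[n --> \oo] --> t * p) ->
  (forall t : R, 0 < t ->
     n.+1%:R * \int[P]_w fsin (X (t / n.+1%:R) w) @[n --> \oo] --> t * q) ->
  forall t : R, 0 <= t -> charfun P (X t) u = cexp (t%:C * (p +i* q)).
Proof.
move=> p0 limc lims t; rewrite le_eqVlt => /predU1P[<-|t0].
  by rewrite levy_charfun0 mul0r cexp0.
pose h n := t / n.+1%:R.
have h0 n : 0 <= h n by rewrite divr_ge0// ltW.
pose b n := cexp ((h n)%:C * (p +i* q)).
have hn n : h n *+ n.+1 = t by rewrite -mulr_natr divfK.
have tb n : cexp (t%:C * (p +i* q)) = b n ^+ n.+1.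
  by rewrite /b -cexp_mulrn -mulrnAl -rmorphMn/= hn.
pose D n := `|complex.Re (charfun P (X (h n)) u - b n)| +
  `|complex.Im (charfun P (X (h n)) u - b n)|.
have bound n : `|charfun P (X t) u - cexp (t%:C * (p +i* q))| <= (n.+1%:R * D n)%:C.
  rewrite (tb n) -{1}(hn n) levy_charfun_mulrn//.
  apply: le_trans (norm_expB_le _ _ _) _.
  - by apply: charfun_norm_le1; exact: mX.
  - by apply: norm_cexp_le1; rewrite /=; simpc; rewrite /= mulr_ge0_le0.
  by rewrite mulr_natl rmorphMn; apply: ler_wMn2r; exact: normc_le.
have D0 : n.+1%:R * D n @[n --> \oo] --> 0.
  have [ec es] := cvg_cexp_quotient (t * p) (t * q).
  pose a n : R := n.+1%:R * (\int[P]_w fcos (X (h n) w) - 1) -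
    n.+1%:R * (expR (t * p / n.+1%:R) * cos (t * q / n.+1%:R) - 1).
  pose c n : R := n.+1%:R * \int[P]_w fsin (X (h n) w) -
    n.+1%:R * (expR (t * p / n.+1%:R) * sin (t * q / n.+1%:R)).
  have a0 : `|a n| @[n --> \oo] --> 0.
    rewrite -(normr0 R) -(subrr (t * p)); apply: cvg_norm.
    by apply: cvgB => //; exact: limc.
  have c0 : `|c n| @[n --> \oo] --> 0.
    rewrite -(normr0 R) -(subrr (t * q)); apply: cvg_norm.
    by apply: cvgB => //; exact: lims.
  rewrite (_ : (fun n => n.+1%:R * D n) = (fun n => `|a n| + `|c n|)).
    by rewrite -(addr0 0); exact: cvgD.
  apply/funext => n; have nn (x : R) : n.+1%:R * `|x| = `|n.+1%:R * x|.
    by rewrite normrM normr_nat.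
  rewrite /D mulrDr !nn.
  have hp : h n * p = t * p / n.+1%:R by rewrite /h mulrAC.
  have hq : h n * q = t * q / n.+1%:R by rewrite /h mulrAC.
  have bE : b n = (expR (t * p / n.+1%:R) * cos (t * q / n.+1%:R)) +i*
      (expR (t * p / n.+1%:R) * sin (t * q / n.+1%:R)).
    by rewrite /b -hp -hq /cexp /=; congr (expR _ * cos _ +i* (expR _ * sin _)); simpc.
  rewrite bE charfunE /= /a /c; congr (_ + _); congr (Num.norm _); ring.
apply/eqP; rewrite -subr_eq0 -normr_eq0 normc_def; apply/eqP; congr (_%:C).
set N := Num.sqrt _.
have boundN n : N <= n.+1%:R * D n by rewrite -lecR; have := bound n; rewrite normc_def.
apply/eqP; rewrite eq_le sqrtr_ge0 andbT -(cvg_lim _ D0)//.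
by apply: limr_ge; [apply/cvg_ex; exists 0|exact: nearW].
Qed.

End levy_charfun.

(** * The Levy measure of the subordinated process *)

Section levy_measure_limit.
Context d (T : measurableType d) (R : realType) (P : probability T R).
Variables (k : nat) (lambda : 'I_k -> R) (delta gamma : R).
Variables (Y : R -> T -> R) (M : R -> T -> nat).
Hypothesis k_gt0 : (0 < k)%N.
Hypothesis lambda_gt0 : forall j, 0 < lambda j.
Hypotheses (delta_gt0 : 0 < delta) (gamma_gt0 : 0 < gamma).
Hypothesis igsY : inverse_gaussian_subordinator P delta gamma Y.
Hypothesis gcpM : generalized_counting_process P lambda M.
Hypothesis indep : independent2 P (process_sigma M) (process_sigma Y).
Local Notation mu := (@lebesgue_measure R).
Local Notation rho := (igs_levy_density delta gamma).
Let Lambda := \sum_(j < k) lambda j.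
Let Z t w : R := (M (Y t w) w)%:R.

Let weight n := NngNum (levy_weight_ge0 gamma delta_gt0 lambda_gt0 n).

Definition subordinated_levy_measure := atomic_measure weight.
Local Notation nu := subordinated_levy_measure.

Let mM t : 0 <= t -> measurable_fun setT (M t).
Proof. exact: (gcp_measurable gcpM). Qed.

Let subY : subordinator P Y. Proof. by have [] := igsY. Qed.

Let mphi A : measurable_fun setT (gcp_marginal P M A).
Proof. exact: (measurable_gcp_marginal lambda_gt0 gcpM). Qed.

Let mean (g : nat -> R) (x : R) : R := \int[P]_w g (M `|x| w).

Let meanE (g : nat -> R) (b x : R) : (forall n, 0 <= g n <= b) ->
  (mean g x)%:E = (\int[P]_w (g (M `|x| w))%:E)%E.
Proof.
move=> gb; rewrite /mean /Rintegral fineK//; apply: integrable_fin_num => //.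
apply: (@integrable_bounded_prob _ _ _ P _ b).
  by apply: measurableT_comp; last exact: mM.
by move=> w; have /andP[g0 ?] := gb (M `|x| w); rewrite ger0_norm.
Qed.

Let mean_series (g : nat -> R) (b x : R) : (forall n, 0 <= g n <= b) ->
  ((mean g x)%:E = \sum_(n <oo) (g n * gcp_marginal P M [set n] x)%:E)%E.
Proof.
move=> gb; rewrite (meanE _ gb) integral_nat_valued; last 2 first.
- exact: mM.
- by move=> n; case/andP: (gb n).
apply: eq_eseriesr => n _; rewrite EFinM /gcp_marginal fineK// fin_num_measure//.
by apply: measurable_fun_fiber; exact: mM.
Qed.

Let mean_ge0 (g : nat -> R) (b x : R) : (forall n, 0 <= g n <= b) -> 0 <= mean g x.
Proof. by move=> gb; apply: Rintegral_ge0 => w _; case/andP: (gb (M `|x| w)). Qed.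

Let measurable_mean (g : nat -> R) (b : R) : (forall n, 0 <= g n <= b) ->
  measurable_fun setT (mean g).
Proof.
move=> gb; apply/measurable_EFinP.
rewrite (_ : _ \o _ = fun x => (\sum_(n <oo) (g n * gcp_marginal P M [set n] x)%:E)%E).
  apply: ge0_emeasurable_sum => n.
    by move=> x _ _; rewrite lee_fin mulr_ge0 ?gcp_marginal_ge0//; case/andP: (gb n).
  by move=> _; apply/measurable_EFinP; apply: measurable_funM => //; exact: mphi.
by apply/funext => x; rewrite /= (mean_series _ gb).
Qed.

Let mean_subordinated (g : nat -> R) (b h : R) : 0 <= h -> (forall n, 0 <= g n <= b) ->
  (\int[P]_w (mean g (Y h w))%:E = \int[P]_w (g (M (Y h w) w))%:E)%E.
Proof.
move=> h0 gb; have g0 n : 0 <= g n by case/andP: (gb n).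
have mYh : measurable_fun setT (Y h) by have [[mY _ _ _ _] _ _] := subY; exact: mY.
under eq_integral do rewrite (mean_series _ gb).
rewrite integral_nneseries//; last 2 first.
- move=> n; apply/measurable_EFinP; apply: measurable_funM => //.
  by apply: measurableT_comp mYh; exact: mphi.
- by move=> n w _; rewrite lee_fin mulr_ge0 ?gcp_marginal_ge0.
rewrite (@integral_nat_valued _ _ _ P (fun w => M (Y h w) w))//; last first.
  move=> _ A _; rewrite setTI.
  exact: (subordinated_marginal lambda_gt0 gcpM subY indep A h0).1.
apply: eq_eseriesr => n _; under eq_integral do rewrite EFinM.
rewrite ge0_integralZl_EFin//; last 2 first.
- by move=> w _; rewrite lee_fin gcp_marginal_ge0.
- by apply/measurable_EFinP; apply: measurableT_comp mYh; exact: mphi.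
by congr (_ * _)%E; rewrite -(subordinated_marginal lambda_gt0 gcpM subY indep [set n] h0).2.
Qed.

Let integral_levy_measure (G : R -> R) (b : R) : measurable_fun setT G ->
  (forall x, 0 <= G x <= b) -> G 0 = 0 ->
  (\int[nu]_x (G x)%:E = \int[mu]_x (rho x * mean (fun n => G n%:R) x)%:E)%E.
Proof.
move=> mG Gb G0; have Gge0 x : 0 <= G x by case/andP: (Gb x).
rewrite integral_atomic//=.
rewrite (@igs_mixture_integral _ _ _ P _ lambda M delta gamma delta_gt0 gamma_gt0
  lambda_gt0 gcpM k_gt0 (fun n => G n%:R))//.
by apply: eq_integral => x _; rewrite [RHS]EFinM; congr (_ * _)%E; rewrite (meanE x (fun n => Gb n%:R)).
Qed.

(** The total mass is the integral against the Levy density of [Y] of the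
    probability that [M x] is nonzero. *)
Lemma subordinated_levy_measure_fin : (nu setT < +oo)%E.
Proof.
have g01 (n : nat) : 0 <= ((n != 0%N)%:R : R) <= 1 by case: (n != 0%N); rewrite ?lexx ?ler01.
have -> : (nu setT = \int[mu]_x ((rho x)%:E * \int[P]_w ((M `|x| w != 0%N)%:R : R)%:E))%E.
  rewrite /nu atomic_measureE.
  rewrite -(@igs_mixture_integral _ _ _ P _ lambda M delta gamma delta_gt0 gamma_gt0
    lambda_gt0 gcpM k_gt0 (fun n => (n != 0%N)%:R))//.
  apply: eq_eseriesr => -[|n] _; first by rewrite /= mul0e mul0r.
  by rewrite diracT mule1 mulr1.
have L0 : 0 <= Lambda by apply: sumr_ge0 => j _; exact: ltW.
apply: le_lt_trans (igs_levy_density_mass delta_gt0 gamma_gt0 L0).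
rewrite le_eqVlt; apply/orP; left; apply/eqP; apply: eq_integral => x _.
rewrite [RHS]EFinM; congr (_ * _)%E.
rewrite EFinB -(gcp_no_jump lambda_gt0 gcpM (normr_ge0 x)).
rewrite -probability_setC; last by apply: measurable_fun_fiber; exact: mM.
rewrite -(integral_indic_comp P (mM (normr_ge0 x)) (B := ~` [set 0%N]))//.
apply: eq_integral => w _; congr EFin; rewrite indicE; congr (nat_of_bool _)%:R.
by apply/idP/idP => [/eqP ?|/set_mem/eqP//]; exact/mem_set.
Qed.

Let integrable_nu (G : R -> R) (b : R) : measurable_fun setT G ->
  (forall x, `|G x| <= b) -> nu.-integrable setT (EFin \o G).
Proof. exact: (integrable_bounded subordinated_levy_measure_fin). Qed.

Let small_time_ge0 (G : R -> R) (b t : R) : 0 < t -> measurable_fun setT G ->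
  (forall x, 0 <= G x <= b) -> G 0 = 0 ->
  n.+1%:R * \int[P]_w G (Z (t / n.+1%:R) w) @[n --> \oo] --> t * \int[nu]_x G x.
Proof.
move=> t0 mG Gb G0; have Gge0 x : 0 <= G x by case/andP: (Gb x).
have Gn n : 0 <= G n%:R <= b by exact: Gb.
pose h n : R := t / n.+1%:R.
have h0 n : 0 < h n by rewrite divr_gt0.
pose e n : R := (h n * expR (delta * gamma * h n))^-1.
have := igs_small_time delta_gt0 igsY t0 (measurable_mean Gn)
  (fun x => mean_ge0 x Gn).
rewrite -(integral_levy_measure mG Gb G0).
have Zfin n : (\int[P]_w (G (Z (h n) w))%:E)%E \is a fin_num.
  apply: integrable_fin_num => //; apply: (@integrable_bounded_prob _ _ _ P _ b).
    apply: measurableT_comp => //.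
    by apply: (measurable_subordinated lambda_gt0 gcpM subY indep); exact: ltW.
  by move=> w; rewrite ger0_norm//; case/andP: (Gb (Z (h n) w)).
rewrite (_ : (fun n => _) = (fun n => (e n * \int[P]_w G (Z (h n) w))%:E)); last first.
  apply/funext => n; rewrite (mean_subordinated (ltW (h0 n)) Gn) EFinM.
  by rewrite /Rintegral fineK.
have -> : (\int[nu]_x (G x)%:E = (\int[nu]_x G x)%:E)%E.
  rewrite /Rintegral fineK//; apply: integrable_fin_num => //.
  by apply: (integrable_nu (b := b)) => // x; rewrite ger0_norm//; case/andP: (Gb x).
move=> /fine_cvgP[_ eG].
have : t * expR (delta * gamma * h n) * (e n * \int[P]_w G (Z (h n) w)) @[n --> \oo] -->
    t * 1 * \int[nu]_x G x.
  apply: cvgM => //; apply: cvgM; first exact: cvg_cst.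
  rewrite -(expR0 R); apply: continuous_cvg; first exact: continuous_expR.
  rewrite (_ : 0 = delta * gamma * (t * 0)); last by rewrite !mulr0.
  apply: cvgM; first exact: cvg_cst.
  by apply: cvgM; [exact: cvg_cst|exact: cvg_harmonic].
rewrite mulr1; apply: cvg_trans; apply: near_eq_cvg; apply: nearW => n.
rewrite mulrA /e invfM /h; congr (_ * _).
have := expR_gt0 (delta * gamma * (t / n.+1%:R)); set E := expR _ => E0.
by field; rewrite !gt_eqF//.
Qed.

(** Adding a multiple of the indicator of the nonzero reals makes [G] nonnegative
    without changing its value at 0. *)
Lemma subordinated_small_time (G : R -> R) (b t : R) : 0 < t ->
  measurable_fun setT G -> (forall x, `|G x| <= b) -> G 0 = 0 ->
  n.+1%:R * \int[P]_w G (Z (t / n.+1%:R) w) @[n --> \oo] --> t * \int[nu]_x G x.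
Proof.
move=> t0 mG Gb G0; have b0 : 0 <= b by exact: le_trans (Gb 0).
(* [G + J] is nonnegative and still vanishes at 0. *)
pose J (x : R) : R := b * \1_(~` [set 0]) x.
have mJ : measurable_fun setT J.
  by apply: measurable_funM => //; apply: measurable_indic; exact: measurableC.
have Jb x : 0 <= J x <= b.
  by rewrite /J indicE; case: (x \in _); rewrite ?mulr1 ?mulr0 ?lexx ?b0.
have J0 : J 0 = 0 by rewrite /J indicE memNset ?mulr0//=; apply.
have GJb x : 0 <= G x + J x <= b + b.
  have [->|x0] := eqVneq x 0; first by rewrite G0 J0 addr0 lexx addr_ge0.
  have := Gb x; rewrite ler_norml => /andP[? ?].
  rewrite /J indicE mem_set/= ?mulr1; last by move/eqP: x0.
  by apply/andP; split; lra.
have mGJ : measurable_fun setT (fun x => G x + J x) by exact: measurable_funD.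
have Jabs x : `|J x| <= b by have /andP[J0' ?] := Jb x; rewrite ger0_norm.
have GJabs x : `|G x + J x| <= b + b by have /andP[? ?] := GJb x; rewrite ger0_norm.
have GJ0 : G 0 + J 0 = 0 by rewrite G0 J0 addr0.
have limGJ := small_time_ge0 t0 mGJ GJb GJ0.
have limJ := small_time_ge0 t0 mJ Jb J0.
have split_nu : \int[nu]_x G x = \int[nu]_x (G x + J x) - \int[nu]_x J x.
  rewrite -RintegralB//; [|exact: integrable_nu GJabs|exact: integrable_nu Jabs].
  by apply: eq_Rintegral => x _; rewrite addrK.
rewrite split_nu mulrBr.
suff E n : n.+1%:R * \int[P]_w G (Z (t / n.+1%:R) w) =
    n.+1%:R * \int[P]_w (G (Z (t / n.+1%:R) w) + J (Z (t / n.+1%:R) w)) -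
    n.+1%:R * \int[P]_w J (Z (t / n.+1%:R) w).
  by under eq_fun do rewrite E; exact: cvgB.
have h0 : 0 <= t / n.+1%:R by rewrite divr_ge0// ltW.
have mZ := measurable_subordinated lambda_gt0 gcpM subY indep h0.
rewrite -mulrBr; congr (_ * _).
rewrite -RintegralB//.
- by apply: eq_Rintegral => w _; rewrite addrK.
- apply: (@integrable_bounded_prob _ _ _ P _ (b + b)) => //.
  exact: (measurableT_comp mGJ mZ).
- apply: (@integrable_bounded_prob _ _ _ P _ b) => //.
  exact: (measurableT_comp mJ mZ).
Qed.

Lemma subordinated_charfun (u t : R) : 0 <= t ->
  charfun P (Z t) u =
  cexp (t%:C%C * (\int[nu]_x (cos (u * x) - 1) +i* \int[nu]_x sin (u * x))%C).
Proof.
have mcos : measurable_fun setT (fun x : R => cos (u * x)).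
  apply: measurableT_comp; last exact: measurable_funM.
  by apply: continuous_measurable_fun; exact: continuous_cos.
have msin : measurable_fun setT (fun x : R => sin (u * x)).
  apply: measurableT_comp; last exact: measurable_funM.
  by apply: continuous_measurable_fun; exact: continuous_sin.
have cos1b (x : R) : `|cos (u * x) - 1| <= 2.
  apply: le_trans (ler_normB _ _) _; rewrite normr1 (_ : 2 = 1 + 1)// lerD2r.
  exact: cos_max.
apply: (levy_charfun_exponent (subordinated_levy lambda_gt0 gcpM subY indep)).
- have := @Rintegral_cst _ _ _ nu _ measurableT 0; rewrite mul0r => <-.
  apply: le_Rintegral => //.
  + by apply: (integrable_nu (b := 2)) => //; exact: measurable_funB.
  + by apply: (integrable_nu (b := 0)) => // x; rewrite normr0.
- move=> s s0.
  have := @subordinated_small_time (fun x => cos (u * x) - 1) 2 s s0.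
  rewrite mulr0 cos0 subrr => /(_ (measurable_funB mcos (measurable_cst _)) cos1b erefl).
  apply: cvg_trans; apply: near_eq_cvg; apply: nearW => n; congr (_ * _).
  rewrite RintegralB//.
  + by rewrite Rintegral_prob_cst.
  + apply: (@integrable_bounded_prob _ _ _ P _ 1); last by move=> w; exact: cos_max.
    apply: (measurableT_comp mcos).
    apply: (measurable_subordinated lambda_gt0 gcpM subY indep).
    by rewrite divr_ge0// ltW.
  + by apply: (@integrable_bounded_prob _ _ _ P _ 1) => // w; rewrite normr1.
- move=> s s0; apply: (@subordinated_small_time (fun x => sin (u * x)) 1 s s0) => //.
    by move=> x; exact: sin_max.
  by rewrite mulr0 sin0.
Qed.

Lemma subordinated_levy_measureE (A : set R) :
  nu A = ((delta / Num.sqrt (2 * pi))%:E * \sum_(1 <= n <oo)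
    ((levy_coefficient lambda gamma n)%:E * \d_(n%:R : R) A))%E.
Proof.
rewrite /nu atomic_measureE nneseries_recl//; last by move=> n _; rewrite mule_ge0.
rewrite /= mul0e add0e -nneseriesZl; last first.
  by move=> n _; rewrite mule_ge0// lee_fin levy_coefficient_ge0.
congr (limn _); apply/funext => m; apply: eq_big_nat => -[//|n] _ /=.
by rewrite muleA -EFinM.
Qed.

(** As the measure is finite, the compensator of the jumps of size at most 1 is
    integrable, and its integral is the drift [a]; there is no Gaussian part. *)
Lemma subordinated_levy_measureP : levy_measure_of P Z nu.
Proof.
split.
- exact: subordinated_levy.
- rewrite subordinated_levy_measureE eseries0 ?mule0// => -[//|n] _ _.
  by rewrite diracE memNset ?mule0//= => /eqP; rewrite pnatr_eq0.
- apply: le_lt_trans subordinated_levy_measure_fin.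
  apply: (@le_trans _ _ (\int[nu]_x 1)%E); last by rewrite integral_cst// mul1e.
  apply: ge0_le_integral => //.
  + by move=> x _; rewrite lee_fin le_min ler01 sqr_ge0.
  + by apply/measurable_EFinP; exact: measurable_minr.
  + by move=> x _; rewrite lee_fin ge_min lexx.
(* The compensator of the Levy-Khintchine formula, up to the factor [iu]. *)
pose jump (x : R) := if `|x| <= 1 then x else 0.
have mjump : measurable_fun setT jump.
  apply: measurable_fun_ifT => //.
  by apply: measurable_fun_ler => //; exact: measurableT_comp.
have jump1 x : `|jump x| <= 1 by rewrite /jump; case: ifP => //; rewrite normr0.
exists (\int[nu]_x jump x), 0; split => // t u t0.
rewrite subordinated_charfun//; congr (cexp (_ * _)).
rewrite /levy_khintchine_exponent /cintegral mul0r mul0r.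
have -> : (\int[nu]_x (cos (u * x) - 1)) = \int[nu]_x (complex.Re
    (cexp (0 +i* (u * x)) - 1 - (if `|x| <= 1 then 0 +i* (u * x) else 0)))%C.
  apply: eq_Rintegral => x _; rewrite /cexp /= expR0 mul1r.
  by case: ifP => _ /=; rewrite !oppr0 !addr0.
have -> : \int[nu]_x sin (u * x) = (\int[nu]_x jump x) * u + \int[nu]_x (complex.Im
    (cexp (0 +i* (u * x)) - 1 - (if `|x| <= 1 then 0 +i* (u * x) else 0)))%C.
  have iju : nu.-integrable setT (EFin \o (fun x => jump x * u)).
    apply: (integrable_nu (b := `|u|)); first exact: measurable_funM.
    by move=> x; rewrite normrM ler_piMl.
  have isin : nu.-integrable setT (EFin \o (fun x => sin (u * x))).
    apply: (integrable_nu (b := 1)); last by move=> x; exact: sin_max.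
    apply: measurableT_comp; last exact: measurable_funM.
    by apply: continuous_measurable_fun; exact: continuous_sin.
  rewrite -RintegralZr//; last exact: (integrable_nu (b := 1)).
  rewrite -[LHS](subrKC (\int[nu]_x (jump x * u))) -RintegralB//; congr (_ + _).
  apply: eq_Rintegral => x _; rewrite /cexp /= expR0 mul1r /jump.
  by case: ifP => _ /=; ring.
by simpc.
Qed.

End levy_measure_limit.

Theorem proposition4p6 (R : realType) (d : measure_display)
    (T : measurableType d) (P : probability T R)
    (k : nat) (lambda : 'I_k -> R) (delta gamma : R)
    (Y : R -> T -> R) (M : R -> T -> nat)
    (k_ge1 : (1 <= k)%N)
    (lambda_gt0 : forall j, 0 < lambda j)
    (delta_gt0 : 0 < delta) (gamma_gt0 : 0 < gamma)
    (igsY : inverse_gaussian_subordinator P delta gamma Y)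
    (gcpM : generalized_counting_process P lambda M)
    (indMY : independent2 P (process_sigma M) (process_sigma Y)) :
  let Lambda := \sum_(j < k) lambda j in
  let Z := fun (t : R) (w : T) => (M (Y t w) w)%:R : R in
  exists2 Pi : {measure set R -> \bar R},
    levy_measure_of P Z Pi &
    forall A : set R, measurable A ->
      Pi A =
      ((delta / Num.sqrt (2 * pi))%:E *
       \sum_(1 <= n <oo)
         ((\sum_(x in Omega k n)
             (\prod_(j < k) (lambda j ^+ x j / (x j)`!%:R)) *
             (let s := (\sum_(j < k) x j)%N in
              euler_gamma (s%:R - 2^-1) /
              (Lambda + gamma ^+ 2 / 2) `^ (s%:R - 2^-1)))%:E *
          \d_(n%:R : R) A))%E.
Proof.
move=> Lambda Z.
exists (subordinated_levy_measure gamma lambda_gt0 delta_gt0).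
  exact: (subordinated_levy_measureP k_ge1 lambda_gt0 delta_gt0 gamma_gt0 igsY gcpM indMY).
by move=> A _; exact: subordinated_levy_measureE.
Qed.
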